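(* Let $(M^2,\mu)$ be a twisted-austere pair in $\mathbb{R}^n$ with phase $e^{i\theta}$, where $M$ is a $2$-dimensional submanifold of $\mathbb{R}^n$ that is not totally geodesic, and let $\phi=\theta-(n-2)\frac{\pi}{2}$. Then $\sin\phi=0$, and $M$ is a minimal surface in $\mathbb{R}^n$ with $\mu$ a closed and coclosed $1$-form on $M$ with respect to the induced metric (and hence harmonic).
   Context: Identify $T^*\mathbb{R}^n$ with $\mathbb{C}^n$ via $(x,\sum_j y_j\,dx_j)\leftrightarrow (z_j=x_j+iy_j)$. An $n$-dimensional submanifold $L\subset\mathbb{C}^n$ is special Lagrangian with phase $e^{i\theta}$ if both $\sum_j dx_j\wedge dy_j$ and $\operatorname{Im}(e^{i\theta}dz_1\wedge\cdots\wedge dz_n)$ restrict to zero on $L$. For a $k$-dimensional submanifold $M\subset\mathbb{R}^n$ and a smooth $1$-form $\mu$ on $M$, using $T^*\mathbb{R}^n|_M=T^*M\oplus N^*M$ (with $N^*M$ the conormal bundle), set $N^*M+\mu=\{(x,\xi+\mu_x): x\in M,\ \xi\in N^*_xM\}$. The pair $(M,\mu)$ is twisted-austere (with phase $e^{i\theta}$) if $N^*M+\mu$ is special Lagrangian (with phase $e^{i\theta}$). It is a known fact (Karigiannis-Leung) that, with $\phi=\theta-(n-k)\frac{\pi}{2}$, $B=\nabla\mu$, $C=I+iB$ and $A^\nu=\nu\cdot\mathrm{II}$ the second fundamental form in the normal direction $\nu$ (all as matrices in an orthonormal tangent frame), this is equivalent to: $d\mu=0$, $\operatorname{Im}(e^{i\phi}\det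 C)=0$, and $\operatorname{Im}(i^j\sigma_j(A^\nu C^{-1}))=0$ for all normal $\nu$ and all $j=1,\dots,k$, where $\sigma_j$ is the $j$-th elementary symmetric function of the eigenvalues. *)

(* Defs.v *)
From HB Require Import structures.
From mathcomp Require Import all_boot all_order all_algebra.
From mathcomp Require Import all_classical all_reals all_analysis.
From mathcomp Require Import complex.

Set Implicit Arguments.
Unset Strict Implicit.
Unset Printing Implicit Defensive.

Import Order.TTheory GRing.Theory Num.Theory.
Import numFieldNormedType.Exports.

Local Open Scope classical_set_scope.
Local Open Scope ring_scope.

(* [D] is finite-dimensional in every use, so quantifying over all the
   directions [v] amounts to quantifying over the partial derivatives. *)
Fixpoint Ck_on (R : realType) (D E : normedModType R) (r : nat) (U : set D)
    (f : D -> E) : Prop :=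
  match r with
  | 0 => forall x, U x -> {for x, continuous f}
  | r'.+1 => (forall x, U x -> differentiable f x) /\
             (forall v : D, Ck_on r' U (fun x => 'D_v f x))
  end.

Definition smooth_on (R : realType) (D E : normedModType R) (U : set D)
    (f : D -> E) : Prop :=
  forall r, Ck_on r U f.

(* The last clause says that [F] is a homeomorphism from [V] onto a relatively
   open subset of [M]. *)
Definition local_param (R : realType) (E : normedModType R) (k : nat)
    (M : set E) (V : set 'rV[R]_k) (F : 'rV[R]_k -> E) : Prop :=
  [/\ open V,
      smooth_on V F,
      (forall u w, V u -> 'D_w F u = 0 -> w = 0),
      {in V &, injective F}
    & forall W, open W -> W `<=` V ->
        exists2 U : set E, open U & F @` W = M `&` U].

Definition submanifold (R : realType) (E : normedModType R) (k : nat)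
    (M : set E) : Prop :=
  forall p, M p -> exists V F, local_param (k := k) M V F /\ (F @` V) p.

Definition tangent (R : realType) (E : normedModType R) (M : set E) (p v : E)
    : Prop :=
  exists (U : set R) (gamma : R -> E),
    [/\ open U /\ U 0, smooth_on U gamma, (forall t, U t -> M (gamma t)),
        gamma 0 = p & 'D_1 gamma 0 = v].

(* From here on, the point [(x, y)] of ['rV_n * 'rV_n] stands both for the
   covector [sum_j y_j dx_j] at [x] and for the point [x + i y] of [C^n]. *)

Definition dotp (R : realType) (n : nat) (v w : 'rV[R]_n) : R :=
  (v *m w^T) 0 0.

Definition symp (R : realType) (n : nat) (v w : 'rV[R]_n * 'rV[R]_n) : R :=
  dotp v.1 w.2 - dotp v.2 w.1.

Definition cis (R : realType) (t : R) : R[i] := Complex (cos t) (sin t).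

(* [dz_1 /\ ... /\ dz_n] evaluated at [v_1, ..., v_n] *)
Definition dz_wedge (R : realType) (n : nat)
    (v : 'I_n -> 'rV[R]_n * 'rV[R]_n) : R[i] :=
  \det (\matrix_(i < n, j < n) Complex ((v j).1 0 i) ((v j).2 0 i)).

Definition special_lagrangian (R : realType) (n : nat) (theta : R)
    (L : set ('rV[R]_n * 'rV[R]_n)) : Prop :=
  submanifold n L /\
  forall p, L p ->
    (forall v w, tangent L p v -> tangent L p w -> symp v w = 0) /\
    (forall v : 'I_n -> 'rV[R]_n * 'rV[R]_n,
       (forall j, tangent L p (v j)) ->
       complex.Im (cis theta * dz_wedge v) = 0).

Definition normal (R : realType) (n : nat) (M : set 'rV[R]_n)
    (x nu : 'rV[R]_n) : Prop :=
  forall v, tangent M x v -> dotp nu v = 0.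

Definition conormal (R : realType) (n : nat) (M : set 'rV[R]_n)
    (x xi : 'rV[R]_n) : Prop :=
  forall v, tangent M x v -> dotp xi v = 0.

(* The copy of [T^*_x M] in [T^*_x R^n] complementary to the conormal space:
   the covectors that vanish on the normal space. *)
Definition cotangent (R : realType) (n : nat) (M : set 'rV[R]_n)
    (x eta : 'rV[R]_n) : Prop :=
  forall nu, normal M x nu -> dotp eta nu = 0.

Definition smooth_form (R : realType) (n k : nat) (M : set 'rV[R]_n)
    (mu : 'rV[R]_n -> 'rV[R]_n) : Prop :=
  (forall x, M x -> cotangent M x (mu x)) /\
  (forall V (F : 'rV[R]_k -> 'rV[R]_n), local_param M V F ->
     smooth_on V (mu \o F)).

Definition twisted_conormal (R : realType) (n : nat) (M : set 'rV[R]_n)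
    (mu : 'rV[R]_n -> 'rV[R]_n) : set ('rV[R]_n * 'rV[R]_n) :=
  [set p | M p.1 /\ exists2 xi, conormal M p.1 xi & p.2 = xi + mu p.1].

Definition twisted_austere (R : realType) (n k : nat) (theta : R)
    (M : set 'rV[R]_n) (mu : 'rV[R]_n -> 'rV[R]_n) : Prop :=
  [/\ submanifold k M, smooth_form k M mu
    & special_lagrangian theta (twisted_conormal M mu)].

Definition partial (R : realType) (k : nat) (E : normedModType R) (i : 'I_k)
    (f : 'rV[R]_k -> E) : 'rV[R]_k -> E :=
  fun u => 'D_(delta_mx 0 i) f u.

(* The rows of ['J F u] are the coordinate vectors [partial i F u]. *)
Definition metric (R : realType) (n k : nat) (F : 'rV[R]_k -> 'rV[R]_n)
    (u : 'rV[R]_k) : 'M[R]_k :=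
  'J F u *m ('J F u)^T.

Definition normal_part (R : realType) (n k : nat) (F : 'rV[R]_k -> 'rV[R]_n)
    (u : 'rV[R]_k) (w : 'rV[R]_n) : 'rV[R]_n :=
  w - w *m ('J F u)^T *m invmx (metric F u) *m 'J F u.

(* [II(d_i F, d_j F)] *)
Definition second_form (R : realType) (n k : nat) (F : 'rV[R]_k -> 'rV[R]_n)
    (u : 'rV[R]_k) (i j : 'I_k) : 'rV[R]_n :=
  normal_part F u (partial i (partial j F) u).

(* unnormalized: the trace of [II] *)
Definition mean_curvature (R : realType) (n k : nat)
    (F : 'rV[R]_k -> 'rV[R]_n) (u : 'rV[R]_k) : 'rV[R]_n :=
  \sum_(i < k) \sum_(j < k) invmx (metric F u) i j *: second_form F u i j.

Definition totally_geodesic (R : realType) (n k : nat) (M : set 'rV[R]_n)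
    : Prop :=
  forall V (F : 'rV[R]_k -> 'rV[R]_n), local_param M V F ->
    forall u, V u -> forall i j, second_form F u i j = 0.

Definition minimal (R : realType) (n k : nat) (M : set 'rV[R]_n) : Prop :=
  forall V (F : 'rV[R]_k -> 'rV[R]_n), local_param M V F ->
    forall u, V u -> mean_curvature F u = 0.

(* [mu_j = mu(d_j F)] *)
Definition components (R : realType) (n k : nat) (F : 'rV[R]_k -> 'rV[R]_n)
    (mu : 'rV[R]_n -> 'rV[R]_n) (u : 'rV[R]_k) : 'rV[R]_k :=
  mu (F u) *m ('J F u)^T.

(* [(d a)_ij = d_i a_j - d_j a_i] *)
Definition ext_deriv (R : realType) (k : nat) (a : 'rV[R]_k -> 'rV[R]_k)
    (u : 'rV[R]_k) : 'M[R]_k :=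
  \matrix_(i, j) (partial i (fun w => a w 0 j) u
                  - partial j (fun w => a w 0 i) u).

Definition vol_density (R : realType) (k : nat) (g : 'rV[R]_k -> 'M[R]_k)
    (u : 'rV[R]_k) : R :=
  Num.sqrt (\det (g u)).

(* [d^* a = - (1 / sqrt |g|) d_i (sqrt |g| g^ij a_j)] *)
Definition codiff1 (R : realType) (k : nat) (g : 'rV[R]_k -> 'M[R]_k)
    (a : 'rV[R]_k -> 'rV[R]_k) (u : 'rV[R]_k) : R :=
  - (vol_density g u)^-1 *
    \sum_(i < k)
      partial i (fun w => vol_density g w * (a w *m invmx (g w)) 0 i) u.

(* [(d^* om)_j = - (1 / sqrt |g|) g_lj d_i (sqrt |g| g^ia g^lb om_ab)] *)
Definition codiff2 (R : realType) (k : nat) (g : 'rV[R]_k -> 'M[R]_k)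
    (om : 'rV[R]_k -> 'M[R]_k) (u : 'rV[R]_k) : 'rV[R]_k :=
  - (vol_density g u)^-1 *:
    (\row_(l < k) \sum_(i < k)
       partial i (fun w => vol_density g w *
                    (invmx (g w) *m om w *m invmx (g w)) i l) u) *m g u.

(* [d d^* + d^* d] on 1-forms *)
Definition hodge_laplacian (R : realType) (k : nat) (g : 'rV[R]_k -> 'M[R]_k)
    (a : 'rV[R]_k -> 'rV[R]_k) (u : 'rV[R]_k) : 'rV[R]_k :=
  (\row_(j < k) partial j (codiff1 g a) u) + codiff2 g (ext_deriv a) u.

Definition closed_form (R : realType) (n k : nat) (M : set 'rV[R]_n)
    (mu : 'rV[R]_n -> 'rV[R]_n) : Prop :=
  forall V (F : 'rV[R]_k -> 'rV[R]_n), local_param M V F ->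
    forall u, V u -> ext_deriv (components F mu) u = 0.

Definition coclosed_form (R : realType) (n k : nat) (M : set 'rV[R]_n)
    (mu : 'rV[R]_n -> 'rV[R]_n) : Prop :=
  forall V (F : 'rV[R]_k -> 'rV[R]_n), local_param M V F ->
    forall u, V u -> codiff1 (metric F) (components F mu) u = 0.

Definition harmonic_form (R : realType) (n k : nat) (M : set 'rV[R]_n)
    (mu : 'rV[R]_n -> 'rV[R]_n) : Prop :=
  forall V (F : 'rV[R]_k -> 'rV[R]_n), local_param M V F ->
    forall u, V u -> hodge_laplacian (metric F) (components F mu) u = 0.

(* Main.v *)
(* Fix a parametrization F of M near a point, let g be the induced metric and,
   for a normal vector xi, let A^xi be the second fundamental form in the
   direction xi and B = nabla mu, in coordinates. Extend xi to the normal field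
   N along F; then (F, N + mu) is a map into L = N^*M + mu, whose derivatives
   together with the conormal directions span the tangent space of L. Lifting
   each standard basis vector e_j of R^n to L, its tangential part by this map
   and its normal part by a conormal direction, the value of dz_1 ^ ... ^ dz_n
   on the lifts is, since det (1 + XY) = det (1 + YX), a nonzero real multiple
   of e^(i (phi - theta)) det (g + i (B - A^xi)). Hence
     sin phi (det g - det (B - t A^xi)) + cos phi tr (adj g (B - t A^xi)) = 0
   for all real t, while the symplectic form makes B symmetric, i.e. mu closed.

   If sin phi <> 0, the t^2 coefficient gives det A^xi = 0; if A^xi <> 0, it has
   rank one and the t coefficient says that S = (sin phi) B - (cos phi) g
   vanishes on its kernel, whereas the constant coefficient gives
   det S = det g > 0, a contradiction. So sin phi = 0 as soon as the second
   fundamental form is nonzero at one point. Then tr_g B = 0 and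
   tr_g A^xi = 0 at every point: mu is coclosed and M is minimal. *)

Require Import Defs.
From HB Require Import structures.
From mathcomp Require Import all_boot all_order all_algebra.
From mathcomp Require Import all_classical all_reals all_analysis.
From mathcomp Require Import complex ring lra.

Set Implicit Arguments.
Unset Strict Implicit.
Unset Printing Implicit Defensive.

Import Order.TTheory GRing.Theory Num.Theory.
Import numFieldNormedType.Exports.

Local Open Scope classical_set_scope.
Local Open Scope ring_scope.

(** The first-order expansion of [f] at [x] involves only values near [x], so it is also one of [g];
    [diff_unique] then identifies the differential of [g]. *)
Lemma near_eq_differentiable (R : numFieldType) (V W : normedModType R)
    (f g : V -> W) (x : V) :
  {near x, f =1 g} -> differentiable f x -> differentiable g x.
Proof.
move=> fg /diff_locallyP[dc df].
have gE : g \o shift x = cst (g x) + 'd f x +o_ 0 id.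
  apply/eqaddoP => e e0; move/eqaddoP: df => /(_ e e0).
  have fgx := nbhs_singleton fg.
  have : \forall h \near 0, f (h + x) = g (h + x).
    move: fg; rewrite (near_shift 0 x).
    by apply: filterS => h /=; rewrite subr0.
  by apply: filterS2 => h; rewrite !fctE /= fgx => ->.
by apply/diff_locallyP; rewrite (diff_unique dc gE).
Qed.

(** * Smooth maps *)

Section Smooth.
Context {R : realType}.
Implicit Types D E : normedModType R.

(** Formulas for derivatives are available only at points of [U]. As [U] is open, regularity passes
    along them, which is how the inductions below use the product and chain rules. *)
Lemma Ck_on_eq D E r (U : set D) (f g : D -> E) : open U ->
  (forall x, U x -> f x = g x) -> Ck_on r U f -> Ck_on r U g.
Proof.
move=> oU; elim: r f g => [|r IH] f g fg /=.
  move=> fc x Ux; have nfg : {near x, f =1 g}.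
    by near=> y; apply: fg; near: y; exact: open_nbhs_nbhs.
  rewrite /prop_for /continuous_at -(fg _ Ux).
  exact: cvg_trans (near_eq_cvg nfg) (fc x Ux).
move=> [df Dfr].
have nfg x : U x -> {near x, f =1 g}.
  by move=> Ux; near=> y; apply: fg; near: y; exact: open_nbhs_nbhs.
split=> [x Ux|v]; first exact: near_eq_differentiable (nfg x Ux) (df x Ux).
apply: IH (Dfr v) => x Ux; apply: near_eq_derive; exact: nfg.
Unshelve. all: by end_near. Qed.

Lemma Ck_on_continuous D E r (U : set D) (f : D -> E) :
  Ck_on r U f -> forall x, U x -> {for x, continuous f}.
Proof.
by case: r => [//|r] [df _] x /df; exact: differentiable_continuous.
Qed.

Lemma Ck_onW D E r (U : set D) (f : D -> E) : Ck_on r.+1 U f -> Ck_on r U f.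
Proof.
elim: r f => [|r IH] f; first exact: Ck_on_continuous.
by move=> [df Dfr]; split=> // v; apply: IH.
Qed.

Lemma Ck_on_cst D E r (U : set D) (a : E) : Ck_on r U (fun _ => a).
Proof.
elim: r a => [|r IH] a /=; first by move=> x _; exact: cst_continuous.
split=> [x _|v]; first exact: differentiable_cst.
suff -> : (fun x : D => 'D_v (fun=> a) x) = fun=> 0 by exact: IH.
by apply/funext => x; exact: derive_cst.
Qed.

Lemma Ck_onD D E r (U : set D) (f g : D -> E) : open U ->
  Ck_on r U f -> Ck_on r U g -> Ck_on r U (fun x => f x + g x).
Proof.
move=> oU; elim: r f g => [|r IH] f g /=.
  by move=> fc gc x Ux; apply: continuousD; [exact: fc|exact: gc].
move=> [df Df] [dg Dg]; split=> [x Ux|v].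
  by apply: differentiableD; [exact: df|exact: dg].
apply: (Ck_on_eq oU _ (IH _ _ (Df v) (Dg v))) => x Ux.
by rewrite deriveD //; apply: diff_derivable; [exact: df|exact: dg].
Qed.

Lemma Ck_on_sum D E r (U : set D) n (f : 'I_n -> D -> E) : open U ->
  (forall i, Ck_on r U (f i)) -> Ck_on r U (fun x => \sum_i f i x).
Proof.
move=> oU fr; elim: n f fr => [|n IH] f fr.
  have -> : (fun x => \sum_i f i x) = fun=> 0.
    by apply/funext => x; rewrite big_ord0.
  exact: Ck_on_cst.
have -> : (fun x => \sum_i f i x) =
    fun x => f ord0 x + \sum_i f (lift ord0 i) x.
  by apply/funext => x; rewrite big_ord_recl.
by apply: Ck_onD => //; exact: IH.
Qed.

Lemma derive_comp_diff D E E' (f : D -> E) (g dg : E -> E') x v :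
  differentiable f x -> is_diff (f x) g dg ->
  'D_v (g \o f) x = dg ('D_v f x).
Proof.
move=> df dg'; have dgf : differentiable (g \o f) x.
  by apply: differentiable_comp => //; case: dg'.
by rewrite !deriveE // diff_comp //= ?diff_val.
Qed.

(** Being its own differential at every point encodes that [L] is linear and continuous. It then
    commutes with directional derivatives, so the same [L] serves throughout the induction. *)
Lemma Ck_on_lin D E E' r (U : set D) (f : D -> E) (L : E -> E') : open U ->
  (forall y, is_diff y L L) -> Ck_on r U f -> Ck_on r U (fun x => L (f x)).
Proof.
move=> oU dL; elim: r f => [|r IH] f /=.
  move=> fc x Ux; apply: continuous_comp; first exact: fc.
  by apply: differentiable_continuous; case: (dL (f x)).
move=> [df Df]; split=> [x Ux|v].
  by apply: differentiable_comp; [exact: df|case: (dL (f x))].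
apply: (Ck_on_eq oU _ (IH _ (Df v))) => x Ux.
by rewrite -(derive_comp_diff v (df x Ux) (dL (f x))).
Qed.

Lemma Ck_onM D r (U : set D) (f g : D -> R) : open U ->
  Ck_on r U f -> Ck_on r U g -> Ck_on r U (fun x => f x * g x).
Proof.
move=> oU; elim: r f g => [|r IH] f g /=.
  by move=> fc gc x Ux; apply: continuousM; [exact: fc|exact: gc].
move=> fr gr; have [df Df] := fr; have [dg Dg] := gr; split=> [x Ux|v].
  by apply: differentiableM; [exact: df|exact: dg].
have := Ck_onD oU (IH _ _ (Ck_onW fr) (Dg v)) (IH _ _ (Ck_onW gr) (Df v)).
apply: Ck_on_eq => // x Ux.
by rewrite deriveM //; apply: diff_derivable; [exact: df|exact: dg].
Qed.

Lemma is_diff_line D (u w : D) (t : R) :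
  is_diff t (fun t : R => u + t *: w) (fun t => t *: w).
Proof.
exact: is_diff_eq (is_diffD (is_diff_cst u t) (is_diff_scalel t w)) (add0r _).
Qed.

(** Differentiating along the line in the direction [v : R] gives ['D_(v *: w) f] on the same line,
    which keeps the induction going. *)
Lemma Ck_on_line D E r (U : set D) (f : D -> E) (u w : D) :
  open U ->
  Ck_on r U f -> Ck_on r [set t : R | U (u + t *: w)] (fun t => f (u + t *: w)).
Proof.
pose l (t : R) := u + t *: w.
have dl t : is_diff t l (fun t => t *: w) by exact: is_diff_line.
have dlt t : differentiable l t by case: (dl t).
change (open U -> Ck_on r U f -> Ck_on r (l @^-1` U) (f \o l)).
move=> oU; elim: r f => [|r IH] f /=.
  move=> fc t Ut; apply: continuous_comp; last exact: fc.
  exact: differentiable_continuous.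
move=> [df Df]; split=> [t Ut|v]; first exact: differentiable_comp (df _ Ut).
apply: (Ck_on_eq _ _ (IH _ (Df (v *: w)))) => [|t Ut].
  by apply: open_comp => // t _; exact: differentiable_continuous.
rewrite [RHS]deriveE; last exact: differentiable_comp (df _ Ut).
by rewrite (diff_comp (dlt t) (df _ Ut)) /= diff_val deriveE //; exact: df.
Qed.

End Smooth.

(** * Symmetry of second derivatives *)

Section SymmetricDerivatives.
Context {R : realType}.
Implicit Types D E : normedModType R.

Lemma is_derive_line D E (f : D -> E) (u w : D) (t : R) :
  differentiable f (u + t *: w) ->
  is_derive t 1 (fun t => f (u + t *: w)) ('D_w f (u + t *: w)).
Proof.
move=> df; have dl := is_diff_line u w t.
have dlt : differentiable (fun t : R => u + t *: w) t by case: dl.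
have dfl := differentiable_comp dlt df.
apply: DeriveDef; first exact: diff_derivable.
rewrite [LHS](deriveE _ dfl) [RHS](deriveE _ df).
by rewrite (diff_comp dlt df) /= diff_val scale1r.
Qed.

Lemma mean_value_line D (f : D -> R) (u w : D) (h : R) : 0 < h ->
  (forall t, 0 <= t <= h -> differentiable f (u + t *: w)) ->
  exists2 t, 0 <= t <= h & f (u + h *: w) - f u = h * 'D_w f (u + t *: w).
Proof.
move=> h0 df; pose g t := f (u + t *: w).
have dg t : t \in `[0, h] -> is_derive t 1 g ('D_w f (u + t *: w)).
  by move=> th; apply/is_derive_line/df; move: th; rewrite in_itv.
pose dgf (t : R) : R := 'D_w f (u + t *: w).
have cg : {within `[0, h], continuous g}.
  by apply: derivable_within_continuous => t /dg[].
have dg' t : t \in `]0, h[%R -> is_derive t 1 g (dgf t).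
  by move=> th; apply: dg; exact: subset_itv_oo_cc th.
have [t th e] := MVT h0 dg' cg.
exists t; first by have := subset_itv_oo_cc th; rewrite /= in_itv.
by move: e; rewrite /g scale0r addr0 subr0 mulrC.
Qed.

(** The mean value theorem is used twice: along [v] for the increment [f (y + h *: w) - f y], then
    along [w] for ['D_v f]. *)
Lemma mixed_difference D (f : D -> R) (U : set D) (x v w : D) (h : R) :
  Ck_on 2 U f -> 0 < h ->
  (forall s t, 0 <= s <= h -> 0 <= t <= h -> U (x + s *: v + t *: w)) ->
  exists s t, [/\ 0 <= s <= h, 0 <= t <= h &
    f (x + h *: v + h *: w) - f (x + h *: v) - f (x + h *: w) + f x
    = h * (h * 'D_w (fun y => 'D_v f y) (x + s *: v + t *: w))].
Proof.
move=> [df Df] h0 Uh; have [dvf _] := Df v.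
have h0h : 0 <= h <= h by rewrite (ltW h0) lexx.
have hz : 0 <= (0 : R) <= h by apply/andP; split=> //; exact: ltW.
have Uz s : 0 <= s <= h -> U (x + s *: v).
  by move=> sh; have := Uh s 0 sh hz; rewrite scale0r addr0.
pose k y := f (y + h *: w) - f y.
have shd y : is_diff y (fun y : D => y + h *: w) id.
  have := is_diffD (is_diff_id y) (is_diff_cst (h *: w) y).
  by move/is_diff_eq; apply; exact: addr0.
have dk1 y : U (y + h *: w) -> differentiable (fun y => f (y + h *: w)) y.
  move=> Uy; apply: (@differentiable_comp _ _ _ _ (fun y : D => y + h *: w) f).
    by case: (shd y).
  exact: df.
have dk1E y : U (y + h *: w) ->
    'D_v (fun y => f (y + h *: w)) y = 'D_v f (y + h *: w).
  move=> Uy; rewrite [LHS](deriveE _ (dk1 y Uy)) [RHS](deriveE _ (df _ Uy)).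
  have dsh : differentiable (fun y : D => y + h *: w) y by case: (shd y).
  by rewrite (diff_comp dsh (df _ Uy)) /= diff_val.
have dk y : U y -> U (y + h *: w) -> differentiable k y.
  by move=> Uy Uyh; apply: differentiableB; [exact: dk1|exact: df].
have [|s sh e] := @mean_value_line _ k x v h h0.
  by move=> s sh; apply: dk; [exact: Uz|exact: Uh].
have [|t th e'] := @mean_value_line _ (fun y => 'D_v f y) (x + s *: v) w h h0.
  by move=> t th; apply: dvf; exact: Uh.
exists s, t; split=> //; rewrite -e'.
transitivity (k (x + h *: v) - k x); first by rewrite /k; ring.
rewrite e; congr (_ * _).
rewrite (_ : k = (fun y => f (y + h *: w)) - f) // deriveB.
- by congr (_ - _); rewrite dk1E //; exact: Uh.
- by apply/diff_derivable/dk1/Uh.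
- by apply/diff_derivable/df/Uz.
Qed.

Let dist_lt_half (e a b c : R) :
  `|a - c| < e / 2 -> `|b - c| < e / 2 -> `|a - b| <= e.
Proof.
rewrite !ltr_norml ler_norml => /andP[? ?] /andP[? ?].
by apply/andP; split; lra.
Qed.

(** Schwarz's theorem. The second difference over a small parallelogram is symmetric in [v] and [w],
    so the two mixed derivatives take a common value at two points near [x]; their continuity at [x]
    does the rest. *)
Lemma derive_sym D (f : D -> R) (U : set D) (x v w : D) : open U -> U x ->
  Ck_on 2 U f ->
  'D_w (fun y => 'D_v f y) x = 'D_v (fun y => 'D_w f y) x :> R.
Proof.
move=> oU Ux Cf; have [df Df] := Cf.
have [_ /(_ w) cvw] := Df v; have [_ /(_ v) cwv] := Df w.
apply/eqP; rewrite -subr_eq0 -normr_le0; apply/ler_addgt0Pr => e e0.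
rewrite add0r.
have e2 : 0 < e / 2 by rewrite divr_gt0.
have nU : \forall y \near x, U y by exact: open_nbhs_nbhs.
have /cvgrPdist_lt /(_ _ e2) n1 := cvw x Ux.
have /cvgrPdist_lt /(_ _ e2) n2 := cwv x Ux.
have [d /= d0 dP] := (nbhs_ballP x _).1 (filterI nU (filterI n1 n2)).
(* This [h] keeps the parallelogram within [d / 2] of [x]; the summand 1 keeps the denominator
   positive when [v] and [w] vanish. *)
pose h := d / 2 / (1 + `|v| + `|w|).
have S0 : 0 < 1 + `|v| + `|w| by rewrite -addrA ltr_wpDr ?addr_ge0.
have h0 : 0 < h by rewrite !divr_gt0.
have hin s t : 0 <= s <= h -> 0 <= t <= h -> ball x d (x + s *: v + t *: w).
  move=> /andP[s0 sh] /andP[t0 th]; rewrite -ball_normE /=.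
  rewrite -addrA opprD addrA subrr add0r normrN.
  apply: le_lt_trans (ler_normD _ _) _; rewrite !normrZ !ger0_norm //.
  apply: (@le_lt_trans _ _ (h * (1 + `|v| + `|w|))).
    rewrite -addrA mulrDr mulrDr; apply: ler_wpDl.
      by rewrite mulr_ge0 ?ltW.
    by rewrite lerD ?ler_wpM2r.
  by rewrite /h divfK ?gt_eqF// ltr_pdivrMr// ltr_pMr// ltr1n.
have [s [t [sh th e1]]] := @mixed_difference _ f U x v w h Cf h0
  (fun s t sh th => proj1 (dP _ (hin s t sh th))).
have hin' s' t' : 0 <= s' <= h -> 0 <= t' <= h ->
    ball x d (x + s' *: w + t' *: v).
  by move=> s'h t'h; rewrite addrAC; exact: hin.
have [s' [t' [sh' th' e2']]] := @mixed_difference _ f U x w v h Cf h0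
  (fun s t sh th => proj1 (dP _ (hin' s t sh th))).
have [_ [A1 _]] := dP _ (hin s t sh th).
have [_ [_ A2]] := dP _ (hin' s' t' sh' th').
have sw : f (x + h *: v + h *: w) - f (x + h *: v) - f (x + h *: w) + f x =
          f (x + h *: w + h *: v) - f (x + h *: w) - f (x + h *: v) + f x.
  rewrite [x + h *: w + _]addrAC; congr (_ + _); exact: addrAC.
have hn : h != 0 by rewrite gt_eqF.
have E := mulfI hn (mulfI hn (etrans (esym e1) (etrans sw e2'))).
rewrite -E in A2.
exact: dist_lt_half A1 A2.
Qed.

End SymmetricDerivatives.

(** * The Euclidean inner product *)

Section DotProduct.
Context {R : realType} {n : nat}.
Implicit Types x y z : 'rV[R]_n.

Lemma dotpE x y : dotp x y = \sum_j x 0 j * y 0 j.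
Proof. by rewrite /dotp mxE; apply: eq_bigr => j _; rewrite mxE. Qed.

Lemma dotpC x y : dotp x y = dotp y x.
Proof. by rewrite !dotpE; apply: eq_bigr => j _; rewrite mulrC. Qed.

Lemma dotpDl x y z : dotp (x + y) z = dotp x z + dotp y z.
Proof. by rewrite /dotp mulmxDl mxE. Qed.

Lemma dotpDr x y z : dotp z (x + y) = dotp z x + dotp z y.
Proof. by rewrite dotpC dotpDl !(dotpC z). Qed.

Lemma dotpZl a x y : dotp (a *: x) y = a * dotp x y.
Proof. by rewrite /dotp -scalemxAl mxE. Qed.

Lemma dotpZr a x y : dotp x (a *: y) = a * dotp x y.
Proof. by rewrite dotpC dotpZl dotpC. Qed.

Lemma dotpNl x y : dotp (- x) y = - dotp x y.
Proof. by rewrite -scaleN1r dotpZl mulN1r. Qed.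

Lemma dotpBl x y z : dotp (x - y) z = dotp x z - dotp y z.
Proof. by rewrite dotpDl dotpNl. Qed.

Lemma dotpBr x y z : dotp z (x - y) = dotp z x - dotp z y.
Proof. by rewrite dotpC dotpBl !(dotpC z). Qed.

Lemma dotp0l x : dotp 0 x = 0.
Proof. by rewrite /dotp mul0mx mxE. Qed.

Lemma dotp0r x : dotp x 0 = 0.
Proof. by rewrite dotpC dotp0l. Qed.

Lemma dotp_ge0 x : 0 <= dotp x x.
Proof. by rewrite dotpE sumr_ge0 // => j _; rewrite -expr2 sqr_ge0. Qed.

Lemma dotp_eq0 x : dotp x x = 0 -> x = 0.
Proof.
rewrite dotpE => /psumr_eq0P x0; apply/rowP => j; rewrite mxE.
have /x0 : forall i, true -> 0 <= x 0 i * x 0 i.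
  by move=> i _; rewrite -expr2 sqr_ge0.
by move=> /(_ j isT) /eqP; rewrite mulf_eq0 orbb => /eqP.
Qed.

Lemma dotp_gt0 x : x != 0 -> 0 < dotp x x.
Proof.
move=> x0; rewrite lt_def dotp_ge0 andbT; apply: contra x0 => /eqP/dotp_eq0 ->.
by rewrite eqxx.
Qed.

Lemma mulmx_trE m k (A : 'M[R]_(m, n)) (B : 'M[R]_(k, n)) i j :
  (A *m B^T) i j = dotp (row i A) (row j B).
Proof. by rewrite dotpE mxE; apply: eq_bigr => l _; rewrite !mxE. Qed.

End DotProduct.

(** * Calculus of vector-valued maps through their coordinates *)

Section SmoothVectors.
Context {R : realType}.
Implicit Types D E : normedModType R.

Lemma is_diff_coord n (j : 'I_n) (y : 'rV[R]_n) :
  is_diff y (fun x : 'rV[R]_n => x 0 j) (fun x => x 0 j).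
Proof.
have lin : linear (fun x : 'rV[R]_n => x 0 j) by move=> a u v; rewrite !mxE.
pose fM := GRing.isLinear.Build _ _ _ _ _ lin.
pose f : {linear 'rV[R]_n -> R} := HB.pack (fun x : 'rV[R]_n => x 0 j) fM.
by apply: DiffDef; [exact: differentiable_coord|
  exact: (@diff_lin _ _ _ f y (@coord_continuous _ _ _ _ _))].
Qed.

Lemma differentiable_coordE D n (f : D -> 'rV[R]_n) x j :
  differentiable f x -> differentiable (fun y => f y 0 j) x.
Proof.
pose c (y : 'rV[R]_n) := y 0 j.
move=> df; apply: (@differentiable_comp _ _ _ _ f c) => //.
exact: differentiable_coord.
Qed.

Lemma derive_coord D n (f : D -> 'rV[R]_n) x v j : differentiable f x ->
  'D_v (fun y => f y 0 j) x = ('D_v f x) 0 j :> R.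
Proof.
by move=> df; exact: (derive_comp_diff v df (is_diff_coord j (f x))).
Qed.

Lemma Ck_on_coord D n r (U : set D) (f : D -> 'rV[R]_n) j : open U ->
  Ck_on r U f -> Ck_on r U (fun x => f x 0 j).
Proof. by move=> oU; exact: Ck_on_lin oU (is_diff_coord j). Qed.

Lemma Ck_on_dotp D n r (U : set D) (f g : D -> 'rV[R]_n) : open U ->
  Ck_on r U f -> Ck_on r U g -> Ck_on r U (fun x => dotp (f x) (g x)).
Proof.
move=> oU fr gr.
rewrite (_ : (fun x => _) = fun x => \sum_j f x 0 j * g x 0 j); last first.
  by apply/funext => x; rewrite dotpE.
by apply: Ck_on_sum => // j; apply: Ck_onM => //; exact: Ck_on_coord.
Qed.

Lemma Ck_onZl D E r (U : set D) (k : D -> R) (a : E) : open U ->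
  Ck_on r U k -> Ck_on r U (fun x => k x *: a).
Proof.
by move=> oU; exact: Ck_on_lin oU (fun y => is_diff_scalel y a).
Qed.

Lemma Ck_onZr D E r (U : set D) (f : D -> E) (a : R) : open U ->
  Ck_on r U f -> Ck_on r U (fun x => a *: f x).
Proof.
by move=> oU; exact: Ck_on_lin oU (is_diff_scaler a).
Qed.

Lemma Ck_onN D E r (U : set D) (f : D -> E) : open U ->
  Ck_on r U f -> Ck_on r U (fun x => - f x).
Proof.
move=> oU fr; rewrite (_ : (fun x => _) = fun x => -1 *: f x).
  exact: Ck_onZr.
by apply/funext => x; rewrite scaleN1r.
Qed.

Lemma Ck_onZ D n r (U : set D) (k : D -> R) (f : D -> 'rV[R]_n) : open U ->
  Ck_on r U k -> Ck_on r U f -> Ck_on r U (fun x => k x *: f x).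
Proof.
move=> oU kr fr.
rewrite (_ : (fun x => _) =
    fun x => \sum_j (k x * f x 0 j) *: (delta_mx 0 j : 'rV[R]_n)).
  apply: Ck_on_sum => // j; apply: Ck_onZl => //.
  by apply: Ck_onM => //; exact: Ck_on_coord.
apply/funext => x; rewrite [in LHS](row_sum_delta (f x)) scaler_sumr.
by apply: eq_bigr => j _; rewrite scalerA.
Qed.

Lemma Ck_on_pair D E E' r (U : set D) (f : D -> E) (g : D -> E') : open U ->
  Ck_on r U f -> Ck_on r U g -> Ck_on r U (fun x => (f x, g x)).
Proof.
move=> oU fr gr.
rewrite (_ : (fun x => _) = fun x => (f x, 0) + (0, g x)); last first.
  by apply/funext => x; rewrite -[RHS]/(_ + _, _ + _) /= addr0 add0r.
apply: Ck_onD => //.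
  have dl (y : E) : is_diff y (fun y : E => (y, 0 : E')) (fun y => (y, 0)).
    exact: is_diff_pair (is_diff_id y) (is_diff_cst (0 : E') y).
  exact: Ck_on_lin oU dl fr.
have dr (y : E') : is_diff y (fun y : E' => (0 : E, y)) (fun y => (0, y)).
  exact: is_diff_pair (is_diff_cst (0 : E) y) (is_diff_id y).
exact: Ck_on_lin oU dr gr.
Qed.

Lemma derive_pair D E E' (f : D -> E) (g : D -> E') x v :
  differentiable f x -> differentiable g x ->
  'D_v (fun y => (f y, g y)) x = ('D_v f x, 'D_v g x).
Proof.
move=> df dg; rewrite deriveE; last exact: differentiable_pair.
by rewrite diff_pair // !deriveE.
Qed.

Lemma is_derive_dotp D n (f g : D -> 'rV[R]_n) x v :
  differentiable f x -> differentiable g x ->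
  is_derive x v (fun y => dotp (f y) (g y))
    (dotp ('D_v f x) (g x) + dotp (f x) ('D_v g x)).
Proof.
move=> df dg.
have dj j : is_derive x v ((fun y => f y 0 j) * (fun y => g y 0 j))
    (f x 0 j * ('D_v g x) 0 j + g x 0 j * ('D_v f x) 0 j).
  have df' := diff_derivable (v := v) (differentiable_coordE j df).
  have dg' := diff_derivable (v := v) (differentiable_coordE j dg).
  have := is_deriveM (derivableP df') (derivableP dg').
  by rewrite !derive_coord.
have := is_derive_sum dj.
rewrite (_ : \sum_j _ = fun y => dotp (f y) (g y)); last first.
  by apply/funext => y; rewrite fct_sumE dotpE.
move=> H; apply: is_derive_eq H _.
rewrite !dotpE -big_split /=; apply: eq_bigr => j _.
by rewrite addrC [g x 0 j * _]mulrC.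
Qed.

Lemma derive_dotp D n (f g : D -> 'rV[R]_n) x v :
  differentiable f x -> differentiable g x ->
  'D_v (fun y => dotp (f y) (g y)) x
    = dotp ('D_v f x) (g x) + dotp (f x) ('D_v g x) :> R.
Proof. by move=> df dg; case: (is_derive_dotp v df dg). Qed.

Lemma derive_symv D n (f : D -> 'rV[R]_n) (U : set D) x v w : open U -> U x ->
  Ck_on 2 U f ->
  'D_w (fun y => 'D_v f y) x = 'D_v (fun y => 'D_w f y) x.
Proof.
move=> oU Ux Cf; have [df Df] := Cf; apply/rowP => j.
have [dvf _] := Df v; have [dwf _] := Df w.
apply: etrans (esym (derive_coord w j (dvf x Ux))) _.
apply: etrans _ (derive_coord v j (dwf x Ux)).
have nE u : \forall y \near x, ('D_u f y) 0 j = 'D_u (fun y => f y 0 j) y.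
  have nU : \forall y \near x, U y by exact: open_nbhs_nbhs.
  by near=> y; rewrite (derive_coord u j (df y _)) //; exact: (near nU y).
apply: etrans (near_eq_derive _ (nE v)) _.
apply: etrans _ (esym (near_eq_derive _ (nE w))).
exact: (derive_sym _ _ oU Ux (Ck_on_coord j oU Cf)).
Unshelve. all: by end_near. Qed.

End SmoothVectors.

(** * Tangent and normal spaces of a submanifold *)

Section TangentSpaces.
Context {R : realType}.
Implicit Types D E : normedModType R.

Lemma differentiable_bound D E (f : D -> E) (x : D) (e : R) :
  differentiable f x -> 0 < e ->
  exists2 d, 0 < d &
    forall h, `|h| < d -> `|f (x + h) - f x - 'D_h f x| <= e * `|h|.
Proof.
move=> df e0.
have /eqaddoP /(_ e e0) /nbhs_norm0P[d /= d0 dP] := diff_locally df.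
exists d => // h /dP /=.
by rewrite !fctE /= deriveE // [h + x]addrC opprD addrA.
Qed.

Lemma smooth_on_differentiable D E (U : set D) (f : D -> E) (x : D) :
  smooth_on U f -> U x -> differentiable f x.
Proof. by move=> sf; have [df _] := sf 1%N; exact: df. Qed.

Lemma smooth_on_derive D E (U : set D) (f : D -> E) (v : D) :
  smooth_on U f -> smooth_on U (fun x => 'D_v f x).
Proof. by move=> sf r; have [_ Df] := sf r.+1; exact: Df. Qed.

Lemma derive_line0 D E (f : D -> E) (u w : D) : differentiable f u ->
  'D_1 (fun t : R => f (u + t *: w)) 0 = 'D_w f u.
Proof.
have u0 : u + 0 *: w = u by rewrite scale0r addr0.
move=> df; have [_ ->] := @is_derive_line R D E f u w 0
  (eq_ind_r (fun y => differentiable f y) df u0).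
by rewrite u0.
Qed.

Lemma tangent_derive D E (U : set D) (f : D -> E) (L : set E) (u w : D) :
  open U -> U u -> smooth_on U f -> (forall x, U x -> L (f x)) ->
  tangent L (f u) ('D_w f u).
Proof.
move=> oU Uu sf fL.
have lc : continuous (fun t : R => u + t *: w).
  by move=> t; apply: differentiable_continuous; case: (is_diff_line u w t).
exists [set t : R | U (u + t *: w)], (fun t => f (u + t *: w)); split.
- split; last by rewrite /= scale0r addr0.
  exact: (open_comp (fun t _ => lc t) oU).
- by move=> r; exact: Ck_on_line.
- by move=> t; exact: fL.
- by rewrite scale0r addr0.
- exact: derive_line0 (smooth_on_differentiable sf Uu).
Qed.

Lemma mulmxr_lipschitz n k (P : 'M[R]_(n, k)) :
  exists2 c, 0 < c & forall x : 'rV[R]_n, `|x *m P| <= c * `|x|.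
Proof.
have c : continuous (mulmxr P : 'rV[R]_n -> 'rV[R]_k).
  rewrite (_ : (mulmxr P : 'rV[R]_n -> 'rV[R]_k) =
     fun x => \sum_j x 0 j *: row j P); last first.
    by apply/funext => x; rewrite /= mulmx_sum_row.
  have C0 : Ck_on 0 setT (fun x : 'rV[R]_n => \sum_j x 0 j *: row j P).
    apply: Ck_on_sum => [|j]; first exact: openT.
    apply: Ck_onZl; first exact: openT.
    by move=> y _; exact: coord_continuous.
  by move=> x; exact: C0.
exact: (linear_lipschitz c).
Qed.

Lemma dotp_lipschitz n (x : 'rV[R]_n) :
  exists2 c, 0 < c & forall y : 'rV[R]_n, `|dotp x y| <= c * `|y|.
Proof.
have [c c0 cP] := mulmxr_lipschitz x^T.
exists c => // y; apply: le_trans (cP y); rewrite dotpC /dotp.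
rewrite [leRHS]/Num.Def.normr /= mx_normrE.
exact: (le_bigmax _ (fun i : 'I_1 * 'I_1 => `|(y *m x^T) i.1 i.2|) (0, 0)).
Qed.

Lemma jacobian_row_free n k (M : set 'rV[R]_n) V (F : 'rV[R]_k -> 'rV[R]_n) u :
  local_param M V F -> V u -> row_free ('J F u).
Proof.
move=> [_ sF inj _ _] Vu; apply/inj_row_free => w wJ; apply: (inj u) => //.
by rewrite deriveEjacobian //; exact: smooth_on_differentiable sF Vu.
Qed.

(** A tangent vector is the velocity of an arbitrary curve [gam] in [M], not a priori in the image
    of the differential of [F]. The homeomorphism clause writes [gam t] as [F x] with [x] near [u];
    since [xi] kills the linear part of [F x - F u], its product with [gam t - gam 0] is of smaller
    order than [gam t - gam 0], and dividing by [t] concludes. *)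
Lemma normal_param n k (M : set 'rV[R]_n) V (F : 'rV[R]_k -> 'rV[R]_n) u xi :
  local_param M V F -> V u -> (forall w, dotp xi ('D_w F u) = 0) ->
  normal M (F u) xi.
Proof.
move=> lp Vu xiF v [T [gam [[oT T0] sg gM g0 gv]]].
have [oV sF _ _ homeo] := lp.
have dF := smooth_on_differentiable sF Vu.
have dg := smooth_on_differentiable sg T0.
have /row_freeP[P JP] := jacobian_row_free lp Vu.
have [a a0 aP] := mulmxr_lipschitz P.
have [b b0 bP] := dotp_lipschitz xi.
have main (e : R) : 0 < e -> exists2 d, 0 < d & forall t, `|t| < d ->
    `|dotp xi (gam t - gam 0)| <= e * `|gam t - gam 0|.
  (* The first bound lets half of [|h|] absorb the remainder [q], so that [|h|] is at most [2 * a]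
     times [|F x - F u|]; the second makes [b * |q|] at most [e * |F x - F u|]. *)
  move=> e0; pose m := Num.min (1 / (2 * a)) (e / (2 * a * b)).
  have m0 : 0 < m by rewrite lt_min !divr_gt0 ?mulr_gt0.
  have [d d0 dP] := differentiable_bound dF m0.
  have oW : open (V `&` ball u d) by apply: openI => //; exact: ball_open.
  have [U oU FU] := homeo _ oW (@subIsetl _ _ _).
  have Uu : U (gam 0).
    have : (F @` (V `&` ball u d)) (F u).
      by exists u => //; split => //; exact: ballxx.
    by rewrite FU g0 => -[].
  have : nbhs (0 : R) (T `&` gam @^-1` U).
    apply: filterI; first exact: open_nbhs_nbhs.
    have gc := differentiable_continuous dg.
    by apply: gc; exact: open_nbhs_nbhs.
  move=> /nbhs_norm0P[c /= c0 cP]; exists c => // t /cP[/= Tt Ut].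
  have : (F @` (V `&` ball u d)) (gam t) by rewrite FU; split => //; exact: gM.
  move=> [x [Vx xd] xE]; rewrite -xE g0.
  pose h := x - u; have hd : `|h| < d.
    by move: xd; rewrite -ball_normE /= /h distrC.
  have := dP h hd; rewrite /h subrKC -/h.
  set q := F x - F u - 'D_h F u => qh.
  have FE : F x - F u = q + 'D_h F u by rewrite /q subrK.
  have hE : h = (F x - F u) *m P - q *m P.
    rewrite -mulmxBl FE addrC addKr deriveEjacobian // -mulmxA JP mulmx1 //.
  have hF : `|h| <= 2 * a * `|F x - F u|.
    have : `|h| <= a * `|F x - F u| + a * `|q|.
      by rewrite {1}hE (le_trans (ler_normB _ _)) // lerD.
    have : a * `|q| <= `|h| / 2.
      apply: le_trans (ler_wpM2l (ltW a0) qh) _.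
      rewrite mulrA [leRHS]mulrC ler_wpM2r // -ler_pdivlMl //.
      have : m <= 1 / (2 * a) by rewrite /m ge_min lexx.
      by rewrite mul1r invfM mulrC.
    lra.
  rewrite FE dotpDr xiF addr0 -FE.
  apply: le_trans (bP q) _.
  apply: le_trans (ler_wpM2l (ltW b0) qh) _.
  rewrite mulrA; apply: le_trans (ler_wpM2l _ hF) _.
    by rewrite mulr_ge0 ?ltW.
  rewrite mulrA ler_wpM2r //.
  have : m <= e / (2 * a * b) by rewrite /m ge_min lexx orbT.
  by rewrite ler_pdivlMr ?mulr_gt0 //; lra.
apply/eqP; rewrite -normr_le0; apply/ler_addgt0Pr => e e0; rewrite add0r.
(* The bounds [G3] and [G2] add up to [e / s * t * (1 + |v| + b)], which for this [s] is [t * e]. *)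
pose s := 1 + `|v| + b; have s0 : 0 < s by rewrite addr_gt0 // ltr_wpDr.
have es : 0 < e / s by rewrite divr_gt0.
have [d1 d10 d1P] := main _ es.
pose m := Num.min 1 (e / s).
have m0 : 0 < m by rewrite lt_min ltr01 es.
have [d2 d20 d2P] := differentiable_bound dg m0.
pose t := Num.min d1 d2 / 2.
have t0 : 0 < t by rewrite divr_gt0 // lt_min d10.
have tN : `|t| = t by rewrite gtr0_norm.
have mn : Num.min d1 d2 / 2 < Num.min d1 d2.
  by rewrite ltr_pdivrMr // ltr_pMr ?ltr1n // lt_min d10.
have t1 : `|t| < d1 by rewrite tN (lt_le_trans mn) // ge_min lexx.
have t2 : `|t| < d2 by rewrite tN (lt_le_trans mn) // ge_min lexx orbT.
have := d1P t t1; have := d2P t t2.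
have -> : 'D_t gam 0 = t *: v.
  by rewrite -gv !deriveE // -linearZ /= [_ *: 1]mulr1.
rewrite add0r tN; set G := gam t - gam 0 => Gv Gxi.
have m1 : m <= 1 by rewrite /m ge_min lexx.
have m2 : m <= e / s by rewrite /m ge_min lexx orbT.
have tA : t * dotp xi v = dotp xi G - dotp xi (G - t *: v).
  by rewrite (dotpBr G) dotpZr opprB addrC subrK.
have G1 : `|G| <= t + t * `|v|.
  rewrite -(subrK (t *: v) G) (le_trans (ler_normD _ _)) //.
  rewrite normrZ tN lerD2r (le_trans Gv) //.
  by rewrite -{2}(mul1r t) ler_wpM2r // ltW.
have G2 : `|dotp xi (G - t *: v)| <= b * (e / s * t).
  apply: le_trans (bP _) _; apply: (ler_wpM2l (ltW b0)).
  by apply: le_trans Gv _; apply: (ler_wpM2r (ltW t0)).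
have G3 : `|dotp xi G| <= e / s * (t + t * `|v|).
  by apply: le_trans Gxi _; apply: (ler_wpM2l (ltW es)).
rewrite -(ler_pM2l t0) -{1}tN -normrM tA (le_trans (ler_normB _ _)) //.
apply: le_trans (lerD G3 G2) _.
rewrite le_eqVlt; apply/orP; left; apply/eqP.
rewrite -[X in _ = t * X](divfK (lt0r_neq0 s0) e).
by move: (e / s) => q; rewrite /s; ring.
Qed.

End TangentSpaces.

(** * Determinants and phases *)

Section LinearAlgebra.

(** Both sides are the determinants of the block triangular products equated in [E]: all the other
    diagonal blocks are identities. *)
Lemma det_1mulmxC (R : comNzRingType) m n
    (A : 'M[R]_(m, n)) (B : 'M[R]_(n, m)) :
  \det (1%:M + A *m B) = \det (1%:M + B *m A).
Proof.
have E : block_mx 1%:M 0 A 1%:M *m block_mx 1%:M (- B) 0 (1%:M + A *m B)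
       = block_mx (1%:M + B *m A) (- B) 0 1%:M *m block_mx 1%:M 0 A 1%:M.
  rewrite !mulmx_block !(mul1mx, mulmx1, mul0mx, mulmx0, addr0, add0r).
  by rewrite mulmxN mulNmx addrK addrC addrK.
have := congr1 determinant E.
by rewrite !det_mulmx !det_lblock !det_ublock !det1 !mul1r !mulr1.
Qed.

Lemma det2 (R : comNzRingType) (A : 'M[R]_2) :
  \det A = A 0 0 * A 1 1 - A 0 1 * A 1 0.
Proof.
rewrite (expand_det_row _ 0) !big_ord_recl big_ord0 addr0 /cofactor !det_mx11.
rewrite !mxE /= expr0 mul1r expr1 mulN1r mulrN.
by congr (_ * A _ _ - A _ _ * A _ _); exact: val_inj.
Qed.

Lemma mxtrace2 (R : comNzRingType) (A : 'M[R]_2) : \tr A = A 0 0 + A 1 1.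
Proof.
rewrite /mxtrace !big_ord_recl big_ord0 addr0.
by congr (_ + A _ _); exact: val_inj.
Qed.

Lemma sum2 (V : nmodType) (f : 'I_2 -> V) : \sum_i f i = f 0 + f 1.
Proof.
rewrite !big_ord_recl big_ord0 addr0.
by congr (_ + f _); exact: val_inj.
Qed.

Lemma sum22 (V : nmodType) (f : 'I_2 -> 'I_2 -> V) :
  \sum_i \sum_j f i j = f 0 0 + f 0 1 + (f 1 0 + f 1 1).
Proof. by rewrite sum2 !sum2. Qed.

Lemma ord2P (P : 'I_2 -> Prop) : P 0 -> P 1 -> forall i, P i.
Proof.
move=> P0 P1 [[|[|//]] i2].
- by rewrite (_ : Ordinal i2 = 0) //; exact: val_inj.
- by rewrite (_ : Ordinal i2 = 1) //; exact: val_inj.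
Qed.

Lemma sym2 (T : Type) (f : 'I_2 -> 'I_2 -> T) :
  f 0 1 = f 1 0 -> forall i j, f i j = f j i.
Proof. by move=> f01; apply: ord2P; apply: ord2P. Qed.

Lemma sym2_neq0 (V : nmodType) (f : 'I_2 -> 'I_2 -> V) i j :
  f 0 1 = f 1 0 -> f i j != 0 -> [|| f 0 0 != 0, f 0 1 != 0 | f 1 1 != 0].
Proof.
move=> f01; move: i j; apply: ord2P; apply: ord2P; rewrite -?f01 => ->;
  by rewrite ?orbT.
Qed.

Lemma invmx2 (F : fieldType) (A : 'M[F]_2) : \det A != 0 ->
  [/\ invmx A 0 0 = A 1 1 / \det A, invmx A 0 1 = - A 0 1 / \det A,
      invmx A 1 0 = - A 1 0 / \det A & invmx A 1 1 = A 0 0 / \det A].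
Proof.
move=> dA.
pose B := (\det A)^-1 *: (\matrix_(i, j)
  if i == j then A (rev_ord i) (rev_ord i) else - A i j).
have r0 : rev_ord 0 = 1 :> 'I_2 by exact: val_inj.
have r1 : rev_ord 1 = 0 :> 'I_2 by exact: val_inj.
have AB : A *m B = 1%:M.
  rewrite /B -scalemxAr; apply/matrixP; apply: ord2P; apply: ord2P;
    rewrite !mxE sum2 !mxE /= ?r0 ?r1 det2; field; rewrite -det2 //.
have -> : invmx A = B.
  have uA : A \in unitmx by rewrite unitmxE unitfE.
  by rewrite -[LHS]mulmx1 -AB mulKmx.
by split; rewrite /B !mxE /= ?r0 ?r1 mulrC.
Qed.

End LinearAlgebra.

(** * The phase and the complex determinant *)

Section PhaseDeterminant.
Context {R : realType}.

Lemma cisD (a b : R) : cis (a + b) = cis a * cis b.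
Proof.
by rewrite /cis cosD sinD; apply/eqP; rewrite eq_complex /= eqxx addrC eqxx.
Qed.

Lemma cis_natmul (a : R) n : cis (a *+ n) = cis a ^+ n.
Proof.
elim: n => [|n IH]; first by rewrite mulr0n expr0 /cis cos0 sin0.
by rewrite mulrS cisD IH exprS.
Qed.

Lemma cis_pihalf : cis (pi / 2) = 'i%C :> R[i].
Proof. by rewrite /cis cos_pihalf sin_pihalf. Qed.

Local Notation "x %:C" := (real_complex R x) : ring_scope.

(* [T *m J] is the projection to the row space of [J]; the matrix is the
   transpose of [T (J + i K) + i (1 - T J) = i (1 + T (K - J - i J))]. *)
Lemma det_lift n (J K : 'M[R]_(2, n)) (T : 'M[R]_(n, 2)) : J *m T = 1%:M ->
  \det (\matrix_(i < n, j < n)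
     Complex ((row j T *m J) 0 i)
             ((row j T *m K + (delta_mx 0 j - row j T *m J)) 0 i))
  = - 'i%C ^+ n * Complex (1 - \det (K *m T)) (\tr (K *m T)).
Proof.
move=> JT.
pose f := map_mx (real_complex R).
have mapC m p (A : 'M[R]_(m, p)) i j : f m p A i j = (A i j)%:C by rewrite mxE.
set Z := (X in \det X).
pose W := 'i%C *: (1%:M + f _ _ T *m (f _ _ (K - J) - 'i%C *: f _ _ J)).
have WE : W = f _ _ (T *m J) + 'i%C *: f _ _ (T *m K + (1%:M - T *m J)).
  have -> : f _ _ (T *m K + (1%:M - T *m J)) = 1%:M + f _ _ (T *m (K - J)).
    by rewrite /f mulmxBr !(map_mxD, map_mxB) map_mx1 addrCA.
  rewrite /W mulmxBr -scalemxAr -!map_mxM addrA scalerBr scalerA.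
  rewrite -expr2 sqr_i scaleN1r opprK; exact: addrC.
have -> : Z = W^T.
  apply/matrixP => i j; rewrite /Z WE [LHS]mxE [RHS]mxE [RHS]mxE.
  rewrite [LHS]complexE -!row_mul; congr (_ + _); rewrite [RHS]mxE.
    by congr _%:C; rewrite mxE.
  by rewrite mapC; congr (_ * _%:C); rewrite !mxE eqxx eq_sym.
rewrite det_tr detZ det_1mulmxC mulmxBl -scalemxAl -!map_mxM mulmxBl JT.
move: (K *m T) => H.
rewrite map_mxB map_mx1 addrA [1%:M + _]addrC subrK det2 mxtrace2 !mxE /= det2.
rewrite !mulr1 !mulr0 !subr0 mulNr -mulrN; congr (_ * _).
apply/eqP; rewrite eq_complex /=; apply/andP; split; apply/eqP; ring.
Qed.

Lemma Im_cis_mul (t a b : R) :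
  complex.Im (cis t * Complex a b) = sin t * a + cos t * b.
Proof. by rewrite /cis /= addrC. Qed.

(** The factor [- 'i%C ^+ n] is the one produced by [det_lift]. It is also the phase of
    [theta - phi], that is of n pi/2 - pi, and its square is a sign; so only a real factor remains
    in front of [cis phi]. *)
Lemma cis_phase (n : nat) (theta phi : R) :
  phi = theta - (n%:R - 2) * (pi / 2) ->
  cis theta * - 'i%C ^+ n = ((-1) ^+ n)%:C * cis phi.
Proof.
move=> phiE; have -> : theta = phi + (n%:R * (pi / 2) - pi).
  by rewrite phiE; field.
rewrite mulr_natl cisD -cis_pihalf.
have -> : cis ((pi / 2) *+ n - pi) = - cis (pi / 2) ^+ n :> R[i].
  have cp : cis (- pi) = -1 :> R[i].
    rewrite /cis cosN sinN cospi sinpi oppr0; apply/eqP.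
    by rewrite eq_complex /= oppr0 !eqxx.
  by rewrite cisD cis_natmul cp mulrN1.
rewrite -mulrA mulrNN -exprMn -expr2 cis_pihalf sqr_i.
by rewrite rmorphXn rmorphN1 mulrC.
Qed.

Lemma Im_real_mul (a : R) (z : R[i]) :
  complex.Im (a%:C * z) = a * complex.Im z.
Proof. by case: z => x y /=; rewrite mul0r addr0. Qed.

End PhaseDeterminant.

(** * Algebra of the phase equation *)

Section PhaseAlgebra.
Context {R : realFieldType}.

(* With [s = sin phi] and [c = cos phi] this is
   [Im (e^(i phi) det (g + i h)) = 0]. *)
Definition phase_eq (s c g11 g12 g22 h11 h12 h22 : R) : Prop :=
  s * ((g11 * g22 - g12 ^+ 2) - (h11 * h22 - h12 ^+ 2))
  + c * (g11 * h22 + g22 * h11 - 2 * g12 * h12) = 0.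

(** A definite binary form has no isotropic vector. For [w2 != 0], completing the square makes
    [w2 ^+ 2] times the determinant the opposite of a square; for [w2 = 0], isotropy forces
    [s11 = 0]. *)
Lemma isotropic_det_le0 (s11 s12 s22 w1 w2 : R) :
  s11 * w1 ^+ 2 + 2 * s12 * w1 * w2 + s22 * w2 ^+ 2 = 0 ->
  (w1 != 0) || (w2 != 0) -> s11 * s22 - s12 ^+ 2 <= 0.
Proof.
move=> iso w0; have [w20|w20] := eqVneq w2 0.
  move: w0; rewrite w20 eqxx orbF => w10.
  move: iso; rewrite w20 mulr0 expr0n /= mulr0 !addr0 => /eqP.
  rewrite mulf_eq0 expf_eq0 /= (negPf w10) orbF => /eqP ->.
  by rewrite mul0r sub0r oppr_le0 sqr_ge0.
have : w2 ^+ 2 * (s11 * s22 - s12 ^+ 2) = - (s11 * w1 + s12 * w2) ^+ 2.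
  by rewrite -[RHS](addr0) -[in RHS](mulr0 s11) -iso; ring.
have w2p : 0 < w2 ^+ 2 by rewrite exprn_even_gt0.
by move=> e; rewrite -(pmulr_rle0 _ w2p) e oppr_le0 sqr_ge0.
Qed.

Lemma phase_eq_sin_eq0 (s c g11 g12 g22 a11 a12 a22 b11 b12 b22 : R) :
  s ^+ 2 + c ^+ 2 = 1 -> 0 < g11 * g22 - g12 ^+ 2 ->
  (forall t, phase_eq s c g11 g12 g22
     (b11 - t * a11) (b12 - t * a12) (b22 - t * a22)) ->
  [|| a11 != 0, a12 != 0 | a22 != 0] -> s = 0.
Proof.
move=> sc D0 H A0; apply/eqP/negPn/negP => s0.
(* The equation is quadratic in [t], so three values determine its coefficients: [det0] is that of
   t^2 and [lin] that of t. *)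
have E0 := H 0; have E1 := H 1; have E2 := H (-1).
rewrite /phase_eq in E0 E1 E2.
have det0 : s * (a11 * a22 - a12 ^+ 2) = 0 by lra.
have {}det0 : a11 * a22 - a12 ^+ 2 = 0.
  by move/eqP: det0; rewrite mulf_eq0 (negPf s0) => /eqP.
have lin : s * (a11 * b22 + a22 * b11 - 2 * a12 * b12)
         = c * (g11 * a22 + g22 * a11 - 2 * g12 * a12) by lra.
(* If both diagonal entries vanished, [det0] would give [a12 = 0]. Hence one of the kernel vectors
   [(- a12, a11)] and [(a22, - a12)] is nonzero. *)
have diag : (a11 != 0) || (a22 != 0).
  apply: contraLR A0; rewrite !negb_or !negbK => /andP[/eqP a0 /eqP a20].
  rewrite a0 a20 eqxx /= andbT -sqrf_eq0.
  apply/eqP; move: det0; rewrite a0 mul0r sub0r => /eqP.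
  by rewrite oppr_eq0 => /eqP.
(* The form [s B - c g] is isotropic on the kernel of the rank-one form [A],
   yet its determinant is that of [g]. *)
pose x11 := s * b11 - c * g11; pose x12 := s * b12 - c * g12.
pose x22 := s * b22 - c * g22.
have detx : x11 * x22 - x12 ^+ 2 = g11 * g22 - g12 ^+ 2.
  have -> : x11 * x22 - x12 ^+ 2 = (s ^+ 2 + c ^+ 2) * (g11 * g22 - g12 ^+ 2)
    - s * (s * ((g11 * g22 - g12 ^+ 2) - ((b11 - 0 * a11) * (b22 - 0 * a22)
         - (b12 - 0 * a12) ^+ 2)) + c * (g11 * (b22 - 0 * a22)
         + g22 * (b11 - 0 * a11) - 2 * g12 * (b12 - 0 * a12))).
    by rewrite /x11 /x12 /x22; ring.
  by rewrite E0 mulr0 subr0 sc mul1r.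
have lin0 : x11 * a22 - 2 * x12 * a12 + x22 * a11 = 0.
  by rewrite /x11 /x12 /x22; lra.
suff : x11 * x22 - x12 ^+ 2 <= 0 by rewrite detx; apply/negP; rewrite -ltNge.
case/orP: diag => a0.
(* The value of the form at this vector is [a11] times the left side of [lin0] minus [x11] times
   that of [det0]; the other case is symmetric. *)
- apply: (@isotropic_det_le0 _ _ _ (- a12) a11); last by rewrite a0 orbT.
  rewrite -[RHS](mulr0 a11) -lin0 -[LHS](addr0) -[X in _ + X](mulr0 x11) -det0.
  by ring.
- apply: (@isotropic_det_le0 _ _ _ a22 (- a12)); last by rewrite a0.
  rewrite -[RHS](mulr0 a22) -lin0 -[LHS](addr0) -[X in _ + X](mulr0 x22) -det0.
  by ring.
Qed.

(** Without its determinant term the equation is affine in [t]: the value at 0 gives the first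
    trace, and comparison with the value at 1 the second. *)
Lemma phase_eq_trace_eq0 (c g11 g12 g22 a11 a12 a22 b11 b12 b22 : R) :
  c != 0 ->
  (forall t, phase_eq 0 c g11 g12 g22
     (b11 - t * a11) (b12 - t * a12) (b22 - t * a22)) ->
  g11 * b22 + g22 * b11 - 2 * g12 * b12 = 0 /\
  g11 * a22 + g22 * a11 - 2 * g12 * a12 = 0.
Proof.
move=> c0 H; have E0 := H 0; have E1 := H 1; rewrite /phase_eq in E0 E1.
by split; apply: (mulfI c0); rewrite mulr0; lra.
Qed.

End PhaseAlgebra.

(* Failing comparisons of derivatives would otherwise unfold them to limits. *)
Local Opaque derive dotp.

(** * Partial derivatives and the metric *)

Section Coordinates.
Context {R : realType}.
Implicit Types E : normedModType R.

Lemma Ck_on_id E r (U : set E) : Ck_on r U (@id E).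
Proof.
case: r => [|r] /=; first by move=> x _; exact: cvg_id.
split=> [x _|v]; first by case: (is_diff_id x).
rewrite (_ : (fun x => _) = fun=> v); first exact: Ck_on_cst.
by apply/funext => x; exact: derive_id.
Qed.

Lemma partial_eq0 k E (V : set 'rV[R]_k)
    (f : 'rV[R]_k -> E) u i : open V -> V u ->
  (forall w, V w -> f w = 0) -> partial i f u = 0.
Proof.
move=> oV Vu f0.
have nV : \forall w \near u, V w := open_nbhs_nbhs (conj oV Vu).
have f0n : \forall w \near u, f w = cst 0 w.
  by near=> w; apply: f0; exact: (near nV w).
by apply: etrans (near_eq_derive _ f0n) _; exact: derive_cst.
Unshelve. all: by end_near. Qed.

Lemma partial_jacobian n k (F : 'rV[R]_k -> 'rV[R]_n) u i :
  differentiable F u -> partial i F u = row i ('J F u).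
Proof. by move=> dF; rewrite /partial deriveEjacobian // -rowE. Qed.

Lemma metricE n k (F : 'rV[R]_k -> 'rV[R]_n) u i j : differentiable F u ->
  metric F u i j = dotp (partial i F u) (partial j F u).
Proof.
by move=> dF; rewrite !partial_jacobian // /metric mulmx_trE.
Qed.

Lemma metric_sym n k (F : 'rV[R]_k -> 'rV[R]_n) u i j :
  metric F u i j = metric F u j i.
Proof.
have : (metric F u)^T = metric F u by rewrite /metric trmx_mul trmxK.
by move/matrixP => /(_ j i); rewrite mxE.
Qed.

Lemma derive_partial2 E (f : 'rV[R]_2 -> E) u w : differentiable f u ->
  'D_w f u = w 0 0 *: partial 0 f u + w 0 1 *: partial 1 f u.
Proof.
move=> df; rewrite /partial !deriveE // -!linearZ -linearD /=.
congr ('d f u _); rewrite [LHS]row_sum_delta sum2 //.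
Qed.

(** The derivative of [h] is multiplied by [t = 0]. This lets a curve leave a section of the
    conormal bundle in a prescribed fibre direction. *)
Lemma derive_scale0 n (h : R -> 'rV[R]_n) : differentiable h 0 ->
  'D_1 (fun t : R => t *: h t) 0 = h 0.
Proof.
move=> dh.
have ds : differentiable (fun t : R => t *: h t) 0.
  rewrite (_ : (fun t : R => _) =
      \sum_j (fun t : R => (t * h t 0 j) *: (delta_mx 0 j : 'rV[R]_n))).
    apply: differentiable_sum => j; apply: differentiableZl.
    by apply: differentiableM => //; exact: differentiable_coordE.
  apply/funext => t; rewrite [in LHS](row_sum_delta (h t)) scaler_sumr fct_sumE.
  by apply: eq_bigr => j _; rewrite scalerA.
apply/rowP => j; rewrite -(derive_coord (1 : R) j ds).
have dj := diff_derivable (v := (1 : R)) (differentiable_coordE j dh).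
have := is_deriveM (is_derive_id (0 : R) 1) (derivableP dj).
rewrite (_ : id * _ = fun t : R => (t *: h t) 0 j); last first.
  by apply/funext => t; rewrite mxE.
by move=> [_ ->]; rewrite scale0r add0r [_ *: 1]mulr1.
Qed.

End Coordinates.

Local Opaque partial.

(** * The twisted conormal bundle of a surface *)

Section ConormalField.
Context {R : realType} {n : nat}.
Variables (M : set 'rV[R]_n) (V : set 'rV[R]_2) (F : 'rV[R]_2 -> 'rV[R]_n).
Hypothesis lp : local_param M V F.

Lemma param_open : open V. Proof. by case: lp. Qed.

Lemma param_smooth : smooth_on V F. Proof. by case: lp. Qed.

Lemma param_diff x : V x -> differentiable F x.
Proof. exact: smooth_on_differentiable param_smooth. Qed.

Lemma partial_smooth i : smooth_on V (partial i F).
Proof. exact: smooth_on_derive param_smooth. Qed.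

Lemma partial_diff i x : V x -> differentiable (partial i F) x.
Proof. exact: smooth_on_differentiable (partial_smooth i). Qed.

Lemma param_in x : V x -> M (F x).
Proof.
move=> Vx; have [_ _ _ _ /(_ V param_open (@subset_refl _ V))[U _ FU]] := lp.
have : (F @` V) (F x) by exists x.
by rewrite FU => -[].
Qed.

Lemma param_tangent x w : V x -> tangent M (F x) ('D_w F x).
Proof.
by move=> Vx; exact: (tangent_derive w param_open Vx param_smooth param_in).
Qed.

Lemma det_metric x : V x -> \det (metric F x) =
  dotp (partial 0 F x) (partial 0 F x) * dotp (partial 1 F x) (partial 1 F x)
  - dotp (partial 0 F x) (partial 1 F x) ^+ 2.
Proof.
move=> Vx; have gE i j := metricE i j (param_diff Vx); rewrite det2 !gE.
by move: (partial 0 F x) (partial 1 F x) => p q; rewrite [dotp q p]dotpC expr2.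
Qed.

(** A Gram-Schmidt argument: for [w = (- dotp p q, dotp p p)] the vector ['D_w F x] is nonzero, as
    [F] is an immersion, and its squared norm is [dotp p p] times the determinant. *)
Lemma det_metric_gt0 x : V x -> 0 < \det (metric F x).
Proof.
move=> Vx; rewrite det_metric //; have dF := param_diff Vx.
have [_ _ inj _ _] := lp.
set p := partial 0 F x; set q := partial 1 F x.
have p0 : p != 0.
  apply/eqP => /(inj _ _ Vx) /rowP /(_ 0); rewrite !mxE !eqxx.
  by move/eqP; rewrite oner_eq0.
have pp := dotp_gt0 p0.
pose w : 'rV[R]_2 := \row_i (if i == 0 then - dotp p q else dotp p p).
have : 'D_w F x != 0.
  apply/eqP => /(inj _ _ Vx) /rowP /(_ 1); rewrite !mxE /= => e.
  by rewrite e ltxx in pp.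
move/dotp_gt0; rewrite derive_partial2 // !mxE /= -/p -/q.
clearbody p q; rewrite !(dotpDl, dotpDr, dotpZl, dotpZr) [dotp q p]dotpC.
set d := (X in 0 < X).
have -> : d = dotp p p * (dotp p p * dotp q q - dotp p q ^+ 2).
  by rewrite /d; ring.
by rewrite pmulr_rgt0.
Qed.

(* The determinant of the metric times the orthogonal projection of [xi] to
   the normal space at [F x]: polynomial in the partial derivatives of [F]. *)
Definition conormal_field (xi : 'rV[R]_n) (x : 'rV[R]_2) : 'rV[R]_n :=
  let p := partial 0 F x in let q := partial 1 F x in
  (dotp p p * dotp q q - dotp p q * dotp p q) *: xi
  + ((dotp xi q * dotp p q - dotp xi p * dotp q q) *: p
     + (dotp xi p * dotp p q - dotp xi q * dotp p p) *: q).

Lemma conormal_field_smooth xi : smooth_on V (conormal_field xi).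
Proof.
move=> r; have oV := param_open.
have sp i : Ck_on r V (partial i F) by exact: partial_smooth.
have sd i j : Ck_on r V (fun x => dotp (partial i F x) (partial j F x)).
  exact: Ck_on_dotp.
have sx i : Ck_on r V (fun x => dotp xi (partial i F x)).
  by apply: Ck_on_dotp => //; exact: Ck_on_cst.
have sB (f g : 'rV[R]_2 -> R) : Ck_on r V f -> Ck_on r V g ->
    Ck_on r V (fun x => f x - g x).
  by move=> fr gr; apply: Ck_onD => //; exact: Ck_onN.
apply: Ck_onD => //; last apply: Ck_onD => //.
- by apply: Ck_onZl => //; apply: sB; exact: Ck_onM.
- by apply: Ck_onZ => //; apply: sB; exact: Ck_onM.
- by apply: Ck_onZ => //; apply: sB; exact: Ck_onM.
Qed.

Lemma dotp_conormal_field xi x i :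
  dotp (conormal_field xi x) (partial i F x) = 0.
Proof.
rewrite /conormal_field /=.
move: i; apply: ord2P; move: (partial 0 F x) (partial 1 F x) => p q.
  by rewrite !(dotpDl, dotpZl) [dotp q p]dotpC; ring.
by rewrite !(dotpDl, dotpZl); ring.
Qed.

Lemma normal_dotp xi x : V x ->
  (forall i, dotp xi (partial i F x) = 0) -> normal M (F x) xi.
Proof.
move=> Vx xiF; apply: (normal_param lp Vx) => w.
rewrite derive_partial2; last exact: param_diff.
have := xiF 0; have := xiF 1.
move: (partial 0 F x) (partial 1 F x) => p q q0 p0.
by rewrite dotpDr !dotpZr q0 p0 !mulr0 addr0.
Qed.

Lemma conormal_field_conormal xi x :
  V x -> conormal M (F x) (conormal_field xi x).
Proof.
by move=> Vx; apply: normal_dotp => // i; exact: dotp_conormal_field.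
Qed.

Lemma conormal_dotp xi x i : V x -> conormal M (F x) xi ->
  dotp xi (partial i F x) = 0.
Proof. by move=> Vx; apply; exact: param_tangent. Qed.

Lemma conormal_field_fix xi x : V x -> conormal M (F x) xi ->
  conormal_field xi x = \det (metric F x) *: xi.
Proof.
move=> Vx cxi; have xF i := conormal_dotp i Vx cxi.
rewrite /conormal_field det_metric //; have := xF 0; have := xF 1.
move: (partial 0 F x) (partial 1 F x) => p q /= -> ->.
by rewrite !mul0r !subr0 !scale0r !addr0 expr2.
Qed.

End ConormalField.

(** * Tangent vectors of the twisted conormal bundle and the phase equation *)

Section TwistedConormal.
Context {R : realType} {n : nat}.
Variables (M : set 'rV[R]_n) (mu : 'rV[R]_n -> 'rV[R]_n).
Variables (V : set 'rV[R]_2) (F : 'rV[R]_2 -> 'rV[R]_n).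
Hypothesis lp : local_param M V F.
Hypothesis smu : smooth_on V (mu \o F).

Variables (u : 'rV[R]_2) (xi : 'rV[R]_n).
Hypothesis Vu : V u.
Hypothesis cxi : conormal M (F u) xi.

Let oV := param_open lp.
Let D := \det (metric F u).

(* A section of the twisted conormal bundle through [xi + mu (F u)]. *)
Definition lift_section (x : 'rV[R]_2) : 'rV[R]_n :=
  D^-1 *: conormal_field F xi x + mu (F x).

Let D0 : D != 0. Proof. by rewrite gt_eqF // (det_metric_gt0 lp). Qed.

Let cf_smooth eta : smooth_on V (fun x => D^-1 *: conormal_field F eta x).
Proof. by move=> r; exact: Ck_onZr oV (conormal_field_smooth lp eta r). Qed.

Let cf_at eta : conormal M (F u) eta -> D^-1 *: conormal_field F eta u = eta.
Proof.
by move=> ceta; rewrite (conormal_field_fix lp) // scalerA mulVf // scale1r.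
Qed.

Lemma lift_section_at : lift_section u = xi + mu (F u).
Proof. by rewrite /lift_section cf_at. Qed.

Lemma lift_section_smooth : smooth_on V lift_section.
Proof. by move=> r; exact: Ck_onD oV (cf_smooth xi r) (smu r). Qed.

Lemma lift_section_diff : differentiable lift_section u.
Proof. exact: smooth_on_differentiable lift_section_smooth Vu. Qed.

Lemma conormalD x a b :
  conormal M x a -> conormal M x b -> conormal M x (a + b).
Proof. by move=> ca cb v tv; rewrite dotpDl ca // cb // addr0. Qed.

Lemma conormalZ x k a : conormal M x a -> conormal M x (k *: a).
Proof. by move=> ca v tv; rewrite dotpZl ca // mulr0. Qed.

(** The curve [f] follows the section over the line [u + t *: w] and adds [t] times the conormal
    field extending [eta]. It stays in the bundle because both fields are conormal at every point,
    and [derive_scale0] gives the contribution [eta] to the velocity. *)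
Lemma tangent_twisted_conormal w eta : conormal M (F u) eta ->
  tangent (twisted_conormal M mu) (F u, xi + mu (F u))
    ('D_w F u, 'D_w lift_section u + eta).
Proof.
move=> ceta.
pose U : set R := [set t | V (u + t *: w)].
have oU : open U.
  apply: (@open_comp _ _ (fun t : R => u + t *: w)) => // t _.
  by apply: differentiable_continuous; case: (is_diff_line u w t).
have U0 : U 0 by rewrite /U /= scale0r addr0.
pose h (t : R) : 'rV[R]_n := D^-1 *: conormal_field F eta (u + t *: w).
have sh : smooth_on U h by move=> r; exact: Ck_on_line oV (cf_smooth eta r).
pose g1 (t : R) := F (u + t *: w).
pose g2 (t : R) := lift_section (u + t *: w).
pose g3 (t : R) := t *: h t.
have s1 : smooth_on U g1 by move=> r; exact: Ck_on_line oV (param_smooth lp r).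
have s2 : smooth_on U g2.
  by move=> r; exact: Ck_on_line oV (lift_section_smooth r).
have s3 : smooth_on U g3 by move=> r; exact: Ck_onZ oU (Ck_on_id r U) (sh r).
have s23 : smooth_on U (fun t => g2 t + g3 t).
  by move=> r; exact: Ck_onD oU (s2 r) (s3 r).
pose f (t : R) := (g1 t, g2 t + g3 t).
have sf : smooth_on U f by move=> r; exact: Ck_on_pair oU (s1 r) (s23 r).
have fL t : U t -> twisted_conormal M mu (f t).
  move=> Ut; have cf eta' := conormal_field_conormal lp eta' Ut.
  split; first exact: (param_in lp (x := u + t *: w)).
  exists (D^-1 *: conormal_field F xi (u + t *: w) + t *: h t).
    by apply: conormalD; [|apply: conormalZ]; apply: conormalZ; exact: cf.
  by rewrite /f /g2 /g3 /lift_section /= addrAC.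
have d1 := smooth_on_differentiable s1 U0.
have d2 := smooth_on_differentiable s2 U0.
have d3 := smooth_on_differentiable s3 U0.
have d23 := smooth_on_differentiable s23 U0.
have dh := smooth_on_differentiable sh U0.
have -> : (F u, xi + mu (F u)) = f 0.
  by rewrite /f /g1 /g2 /g3 !scale0r !addr0 lift_section_at.
have -> : ('D_w F u, 'D_w lift_section u + eta) = 'D_1 f 0.
  have E1 : 'D_1 f 0 = ('D_1 g1 0, 'D_1 (fun t => g2 t + g3 t) 0).
    exact: derive_pair d1 d23.
  have E0 : 'D_1 g1 0 = 'D_w F u by exact: derive_line0 (param_diff lp Vu).
  have E2 : 'D_1 (fun t => g2 t + g3 t) 0 = 'D_1 g2 0 + 'D_1 g3 0.
    exact: deriveD (diff_derivable d2) (diff_derivable d3).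
  have E3 : 'D_1 g2 0 = 'D_w lift_section u.
    exact: derive_line0 lift_section_diff.
  have E4 : 'D_1 g3 0 = eta.
    by apply: etrans (derive_scale0 dh) _; rewrite /h scale0r addr0 cf_at.
  by rewrite E1 E0 E2 E3 E4.
exact: tangent_derive oU U0 sf fL.
Qed.

(* [lift_form i j] is [(nabla mu - A^xi)(d_i F, d_j F)]. *)
Definition lift_form (i j : 'I_2) : R :=
  dotp (partial i lift_section u) (partial j F u).

(** The Weingarten relation: differentiating the identity that the normal field is orthogonal to
    [partial j F] moves the derivative from the field to [partial j F], with a change of sign. *)
Lemma lift_formE i j : lift_form i j =
  dotp (partial i (mu \o F) u) (partial j F u)
  - dotp xi (partial i (partial j F) u).
Proof.
have dc : differentiable (fun x => D^-1 *: conormal_field F xi x) u.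
  exact: smooth_on_differentiable (cf_smooth xi) Vu.
have dm : differentiable (mu \o F) u by exact: smooth_on_differentiable smu Vu.
have dj : differentiable (partial j F) u by exact (partial_diff lp j Vu).
have E : partial i lift_section u =
    partial i (fun x => D^-1 *: conormal_field F xi x) u
    + partial i (mu \o F) u.
  exact: (deriveD (diff_derivable dc) (diff_derivable dm)).
rewrite /lift_form E dotpDl addrC; congr (_ + _).
apply/eqP; rewrite -addr_eq0; apply/eqP.
rewrite -[X in dotp X (partial i _ _)](cf_at cxi).
have Z : (fun x => dotp (D^-1 *: conormal_field F xi x) (partial j F x)) =
    fun=> 0.
  by apply/funext => x; rewrite dotpZl dotp_conormal_field mulr0.
have := derive_dotp (delta_mx 0 i) dc dj.
by rewrite Z derive_cst => ->.
Qed.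

Lemma twisted_conormal_at : twisted_conormal M mu (F u, xi + mu (F u)).
Proof. by split; [exact: param_in lp _ Vu|exists xi]. Qed.

(** The symplectic form is evaluated on the lifts of the two coordinate vectors, with [eta = 0]. *)
Lemma lift_form_sym theta : special_lagrangian theta (twisted_conormal M mu) ->
  lift_form 0 1 = lift_form 1 0.
Proof.
move=> [_ /(_ _ twisted_conormal_at)[sL _]].
have c0 : conormal M (F u) 0 by move=> v _; exact: dotp0l.
have t w := tangent_twisted_conormal w c0.
have sw (a b c d : 'rV[R]_n) :
    symp (a, b + 0) (c, d + 0) = 0 -> dotp b c = dotp d a.
  by rewrite /symp /= !addr0 (dotpC a) => /eqP; rewrite subr_eq0 => /eqP.
exact: sw (sL _ _ (t (delta_mx 0 0)) (t (delta_mx 0 1))).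
Qed.

Lemma lift_form_phase theta phi : phi = theta - (n%:R - 2) * (pi / 2) ->
  special_lagrangian theta (twisted_conormal M mu) ->
  phase_eq (sin phi) (cos phi)
    (metric F u 0 0) (metric F u 0 1) (metric F u 1 1)
    (lift_form 0 0) (lift_form 0 1) (lift_form 1 1).
Proof.
move=> phiE sL; have symH := lift_form_sym sL.
have [_ /(_ _ twisted_conormal_at)[_ phL]] := sL.
pose J := 'J F u; pose K := 'J lift_section u.
(* A right inverse of [J] for which [T *m J] is the orthogonal projection to the tangent space; its
   row [j] holds the coordinates of the tangential part of the basis vector e_j. *)
pose T := J^T *m invmx (metric F u).
have gU : metric F u \in unitmx by rewrite unitmxE unitfE.
have JT : J *m T = 1%:M by rewrite /T mulmxA mulmxV.
have JJ : J *m J^T = metric F u by [].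
have TG : T *m metric F u = J^T by exact: mulmxKV gU _.
have dF := param_diff lp Vu.
(* The normal part of e_j, used as the conormal direction in its lift. *)
pose eta j : 'rV[R]_n := delta_mx 0 j - row j T *m J.
have ceta j : conormal M (F u) (eta j).
  apply: (normal_dotp lp (xi := eta j) Vu) => i.
  rewrite (partial_jacobian i dF).
  have -> : dotp (eta j) (row i J) = (eta j *m J^T) 0 i.
    by rewrite mulmx_trE row_id.
  by rewrite /eta mulmxBl -mulmxA -rowE JJ -row_mul TG subrr mxE.
have := phL _ (fun j => tangent_twisted_conormal (row j T) (ceta j)).
have -> : dz_wedge (fun j =>
      ('D_(row j T) F u, 'D_(row j T) lift_section u + eta j))
    = - 'i%C ^+ n * Complex (1 - \det (K *m T)) (\tr (K *m T)).
  rewrite -(det_lift K JT) /dz_wedge; congr determinant.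
  apply/matrixP => i j; rewrite [LHS]mxE [RHS]mxE /=.
  rewrite (deriveEjacobian _ dF) (deriveEjacobian _ lift_section_diff).
  by [].
rewrite mulrA (cis_phase phiE) -mulrA Im_real_mul Im_cis_mul.
move/eqP; rewrite mulf_eq0 signr_eq0 /= => /eqP.
have HE : K *m J^T = \matrix_(i, j) lift_form i j.
  apply/matrixP => i j; rewrite [RHS]mxE /lift_form.
  rewrite (partial_jacobian i lift_section_diff) (partial_jacobian j dF).
  exact: mulmx_trE.
have := metric_sym F u 1 0; move: D0; rewrite /T mulmxA HE /D.
move: (metric F u) => g dg g10; have [v00 v01 v10 v11] := invmx2 dg.
rewrite mxtrace2 !mxE !sum2 !mxE v00 v01 v10 v11.
rewrite det_mulmx det_inv [\det (\matrix_(_, _) _)]det2 !mxE.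
move: dg; rewrite det2 g10 -symH /phase_eq.
move: (lift_form 0 0) (lift_form 0 1) (lift_form 1 1) => h00 h01 h11.
(* Here [K *m T] has become the lifted form times the inverse metric, so [e] is the phase equation
   divided by the determinant of the metric. *)
move=> d0 e; apply: (mulfI (invr_neq0 d0)); rewrite mulr0 -[RHS]e.
by field.
Qed.

End TwistedConormal.

(** * The geometry of the surface *)

(** In this form the square root enters only through its inverse, which [divergence_identity] can
    treat as a free variable [r]. *)
Lemma derive_rsqrt (R : realType) (E : normedModType R) (f : E -> R) u v :
  differentiable f u -> 0 < f u ->
  is_derive u v (fun w => (Num.sqrt (f w))^-1)
    (- ((Num.sqrt (f u))^-1 / (2 * f u)) * 'D_v f u).
Proof.
move=> df fu.
have s0 : Num.sqrt (f u) != 0 by rewrite gt_eqF // sqrtr_gt0.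
have [ds Ds] := is_derive1_sqrt fu.
pose g (y : R) := (Num.sqrt y)^-1.
have dg : derivable g (f u) 1 := derivableV s0 ds.
have dg' : differentiable g (f u) by apply/derivable1_diffP.
have Dg : 'D_1 g (f u) = - ((Num.sqrt (f u))^-1 / (2 * f u)) :> R.
  apply: etrans (deriveV s0 ds) _; rewrite Ds.
  rewrite -[X in _ = - (_ / (2 * X))](sqr_sqrtr (ltW fu)) /=.
  have K (s : R) : s != 0 -> - s ^- 2 * (2 * s)^-1 = - (s^-1 / (2 * s ^+ 2)).
    by move=> ?; field.
  exact: K.
have dgf := differentiable_comp df dg'.
apply: DeriveDef; first exact: diff_derivable dgf.
apply: etrans (deriveE v dgf) _; rewrite (diff_comp df dg') /= -(deriveE v df).
move: ('D_v f u) => a.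
have -> : 'd g (f u) a = 'd g (f u) (a *: (1 : R)).
  by congr ('d g _ _); rewrite [RHS]mulr1.
by rewrite linearZ /= -(deriveE (1 : R) dg') Dg [LHS]mulrC.
Qed.

Section NormalPart.
Context {R : realType} {n : nat}.
Variables (M : set 'rV[R]_n) (V : set 'rV[R]_2) (F : 'rV[R]_2 -> 'rV[R]_n).
Hypothesis lp : local_param M V F.
Variable (u : 'rV[R]_2).
Hypothesis Vu : V u.

Lemma metric_unit : metric F u \in unitmx.
Proof. by rewrite unitmxE unitfE gt_eqF // (det_metric_gt0 lp). Qed.

Lemma normal_part_normal w : normal M (F u) (normal_part F u w).
Proof.
apply: (normal_dotp lp Vu) => i.
rewrite (partial_jacobian i (param_diff lp Vu)).
have gU := metric_unit.
pose P := w *m ('J F u)^T.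
have E : P *m invmx (metric F u) *m 'J F u *m ('J F u)^T = P.
  by rewrite -mulmxA -[_ *m _^T]/(metric F u) (mulmxKV gU).
rewrite -[normal_part F u w](row_id 0) -mulmx_trE /normal_part mulmxBl E.
by rewrite /P subrr mxE.
Qed.

Lemma dotp_normal_part xi w : conormal M (F u) xi ->
  dotp xi (normal_part F u w) = dotp xi w.
Proof.
move=> cxi; rewrite /normal_part dotpBr.
set c := w *m _ *m _; suff -> : dotp xi (c *m 'J F u) = 0 by rewrite subr0.
apply: cxi; rewrite -(deriveEjacobian c (param_diff lp Vu)).
exact (param_tangent lp c Vu).
Qed.

(** The normal part of [eta] has the same product with itself as with [eta]; the latter is zero
    because [eta] vanishes on normal vectors. So [eta] equals its tangential projection. *)
Lemma cotangent_jacobian eta :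
  cotangent M (F u) eta -> exists c, eta = c *m 'J F u.
Proof.
move=> ceta; exists (eta *m ('J F u)^T *m invmx (metric F u)).
have nN := normal_part_normal eta.
have : dotp (normal_part F u eta) (normal_part F u eta) = 0.
  by rewrite dotp_normal_part // dotpC; exact: ceta.
by move/dotp_eq0 => e; apply/eqP; rewrite -subr_eq0; apply/eqP.
Qed.

Lemma partial_sym i j : partial i (partial j F) u = partial j (partial i F) u.
Proof.
exact: (derive_symv (delta_mx 0 j) (delta_mx 0 i) (param_open lp) Vu
  (param_smooth lp 2)).
Qed.

End NormalPart.

(* For tangential [mu] and normal [xi] these are the coordinates of [nabla mu]
   and of the second fundamental form in the direction [xi]. *)
Definition nabla_form (R : realType) (n : nat) (mu : 'rV[R]_n -> 'rV[R]_n)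
    (F : 'rV[R]_2 -> 'rV[R]_n) (u : 'rV[R]_2) (i j : 'I_2) : R :=
  dotp (partial i (mu \o F) u) (partial j F u).

Definition shape_form (R : realType) (n : nat) (F : 'rV[R]_2 -> 'rV[R]_n)
    (xi : 'rV[R]_n) (u : 'rV[R]_2) (i j : 'I_2) : R :=
  dotp xi (partial i (partial j F) u).

Lemma mean_curvature2 (R : realType) (n : nat) (F : 'rV[R]_2 -> 'rV[R]_n) u :
  mean_curvature F u =
    invmx (metric F u) 0 0 *: second_form F u 0 0
    + invmx (metric F u) 0 1 *: second_form F u 0 1
    + (invmx (metric F u) 1 0 *: second_form F u 1 0
       + invmx (metric F u) 1 1 *: second_form F u 1 1).
Proof.
exact: (sum22 (fun i j => invmx (metric F u) i j *: second_form F u i j)).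
Qed.

Lemma comb_eq0 (R : realType) (n : nat) (h x y z t : 'rV[R]_n)
    (a b c d hx hy hz ht : R) :
  h = a *: x + b *: y + (c *: z + d *: t) ->
  dotp h x = hx -> dotp h y = hy -> dotp h z = hz -> dotp h t = ht ->
  a * hx + b * hy + (c * hz + d * ht) = 0 -> h = 0.
Proof.
by move=> hE <- <- <- <- h0; apply: dotp_eq0; rewrite {2}hE !dotpDr !dotpZr.
Qed.

(** * Consequences for the phase, the mean curvature and the exterior derivative *)

Section TwistedAustere.
Context {R : realType} {n : nat}.
Variables (theta phi : R) (M : set 'rV[R]_n) (mu : 'rV[R]_n -> 'rV[R]_n).
Hypothesis phiE : phi = theta - (n%:R - 2) * (pi / 2).
Hypothesis sL : special_lagrangian theta (twisted_conormal M mu).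
Variables (V : set 'rV[R]_2) (F : 'rV[R]_2 -> 'rV[R]_n).
Hypothesis lp : local_param M V F.
Hypothesis smu : smooth_on V (mu \o F).

Local Notation nabla := (nabla_form mu F).
Local Notation shape := (shape_form F).

Lemma conormal0 x : conormal M x 0.
Proof. by move=> v _; exact: dotp0l. Qed.

(** The conormal space is closed under scaling, so the phase equation holds at [t *: xi], in which
    the second fundamental form is linear. *)
Lemma phase_line u xi t : V u -> conormal M (F u) xi ->
  phase_eq (sin phi) (cos phi)
    (metric F u 0 0) (metric F u 0 1) (metric F u 1 1)
    (nabla u 0 0 - t * shape xi u 0 0) (nabla u 0 1 - t * shape xi u 0 1)
    (nabla u 1 1 - t * shape xi u 1 1).
Proof.
move=> Vu cxi; have ctxi := conormalZ t cxi.
have := lift_form_phase lp smu Vu ctxi phiE sL.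
have E i j : lift_form mu F u (t *: xi) i j = nabla u i j - t * shape xi u i j.
  by rewrite /shape_form -dotpZl; exact: (lift_formE lp smu Vu ctxi i j).
by rewrite !E.
Qed.

Lemma nabla_sym u i j : V u -> nabla u i j = nabla u j i.
Proof.
move=> Vu; have c0 : conormal M (F u) 0 by exact: conormal0.
have E i' j' : lift_form mu F u 0 i' j' = nabla u i' j'.
  by rewrite [LHS](lift_formE lp smu Vu c0) dotp0l subr0.
apply: (sym2 (f := nabla u)); have := lift_form_sym lp smu Vu c0 sL.
by rewrite !E.
Qed.

Lemma second_form_conormal u i j :
  V u -> conormal M (F u) (second_form F u i j).
Proof.
by move=> Vu; exact: (normal_part_normal lp Vu).
Qed.

Lemma dotp_second_form u xi i j : V u -> conormal M (F u) xi ->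
  dotp xi (second_form F u i j) = shape xi u i j.
Proof.
move=> Vu cxi; exact: (dotp_normal_part lp Vu _ cxi).
Qed.

Lemma shape_sym u xi i j : V u -> shape xi u i j = shape xi u j i.
Proof.
by move=> Vu; exact (congr1 (dotp xi) (partial_sym lp Vu i j)).
Qed.

Local Opaque metric second_form nabla_form shape_form mean_curvature.

Lemma metric_pos u : V u ->
  0 < metric F u 0 0 * metric F u 1 1 - metric F u 0 1 ^+ 2.
Proof.
move=> Vu; have := det_metric_gt0 lp Vu.
by rewrite det2 (metric_sym F u 1 0) expr2.
Qed.

(** The nonzero vector [second_form F u i j] itself serves as the normal direction: the
    corresponding entry of the shape form is its squared norm. *)
Lemma sin_phase_eq0 u i j : V u -> second_form F u i j != 0 -> sin phi = 0.
Proof.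
move=> Vu II0; pose xi := second_form F u i j.
have cxi : conormal M (F u) xi by exact: second_form_conormal.
have Aij : shape xi u i j != 0.
  by rewrite -(dotp_second_form i j Vu cxi) gt_eqF // dotp_gt0.
apply: (phase_eq_sin_eq0 _ (metric_pos Vu) (fun t => phase_line t Vu cxi)).
  by rewrite addrC cos2Dsin2.
exact: sym2_neq0 (shape_sym xi 0 1 Vu) Aij.
Qed.

Section ZeroPhase.
Hypothesis s0 : sin phi = 0.

Let c0 : cos phi != 0.
Proof.
apply/eqP => c0; have := cos2Dsin2 phi.
by rewrite s0 c0 expr0n /= addr0 => /eqP; rewrite eq_sym oner_eq0.
Qed.

Lemma traces_eq0 u xi : V u -> conormal M (F u) xi ->
  metric F u 0 0 * nabla u 1 1 + metric F u 1 1 * nabla u 0 0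
    - 2 * metric F u 0 1 * nabla u 0 1 = 0 /\
  metric F u 0 0 * shape xi u 1 1 + metric F u 1 1 * shape xi u 0 0
    - 2 * metric F u 0 1 * shape xi u 0 1 = 0.
Proof.
move=> Vu cxi; apply: phase_eq_trace_eq0 c0 _ => t.
by have := phase_line t Vu cxi; rewrite s0.
Qed.

(** The mean curvature vector [H] is normal, and the trace of the shape form in the direction [H] is
    its squared norm. *)
Lemma mean_curvature_eq0 u : V u -> mean_curvature F u = 0.
Proof.
move=> Vu; move: (mean_curvature F u) (mean_curvature2 F u) => H HE.
have cH : conormal M (F u) H.
  have cII i j := conormalZ (invmx (metric F u) i j)
    (second_form_conormal i j Vu).
  rewrite HE; exact: conormalD (conormalD (cII 0 0) (cII 0 1))
    (conormalD (cII 1 0) (cII 1 1)).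
have [_ trA] := traces_eq0 Vu cH.
have HII i j := dotp_second_form i j Vu cH.
apply: (comb_eq0 HE (HII 0 0) (HII 0 1) (etrans (HII 1 0) (shape_sym H 1 0 Vu))
          (HII 1 1)).
have D0 : \det (metric F u) != 0 by rewrite gt_eqF // (det_metric_gt0 lp).
have g10 := metric_sym F u 1 0.
move: trA; move: (shape H u 0 0) (shape H u 0 1) (shape H u 1 1) => a00 a01 a11.
move: (metric F u) D0 g10 => g D0 g10; have [-> -> -> ->] := invmx2 D0.
rewrite g10 => trA; rewrite -(mul0r (\det g)^-1) -trA; ring.
Qed.

End ZeroPhase.

Lemma components_derive u i j : V u ->
  partial i (fun w => components F mu w 0 j) u
  = nabla u i j + dotp (mu (F u)) (partial i (partial j F) u) :> R.
Proof.
move=> Vu; have dm : differentiable (mu \o F) u.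
  exact: smooth_on_differentiable smu Vu.
have dj := partial_diff lp j Vu.
have <- : partial i (fun w => dotp ((mu \o F) w) (partial j F w)) u =
    nabla u i j + dotp (mu (F u)) (partial i (partial j F) u) :> R.
  exact: derive_dotp (delta_mx 0 i) dm dj.
have nV : \forall w \near u, V w := open_nbhs_nbhs (conj (param_open lp) Vu).
apply: near_eq_derive; near=> w; have Vw : V w by exact: (near nV w).
rewrite (partial_jacobian j (param_diff lp Vw)) /components mulmx_trE row_id //.
Unshelve. all: by end_near. Qed.

(** The terms with second derivatives of [F] are symmetric in [i] and [j], and [nabla] is symmetric
    by the Lagrangian condition. *)
Lemma ext_deriv_eq0 u : V u -> ext_deriv (components F mu) u = 0.
Proof.
move=> Vu; apply/matrixP => i j; rewrite mxE [RHS]mxE !components_derive //.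
by rewrite (nabla_sym i j Vu) (partial_sym lp Vu i j) subrr.
Qed.

End TwistedAustere.

(** * The divergence in local coordinates *)

Section Divergence.
Context {R : realType}.

Lemma is_derive_mulB (E : normedModType R) (f g h k : E -> R) (u v : E)
    (df dg dh dk : R) :
  is_derive u v f df -> is_derive u v g dg ->
  is_derive u v h dh -> is_derive u v k dk ->
  is_derive u v (fun w => f w * g w - h w * k w)
    (df * g u + f u * dg - (dh * k u + h u * dk)).
Proof.
move=> Df Dg Dh Dk.
apply: is_derive_eq (is_deriveB (is_deriveM Df Dg) (is_deriveM Dh Dk)) _.
by rewrite /GRing.scale /=; ring.
Qed.

(** By the cofactor formula, [sqrt |g|] times the inverse of [g] is the adjugate over [sqrt |g|].
    All remaining factors have the shape [f * g - h * k] treated by [is_derive_mulB]. *)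
Lemma vol_raise (g : 'M[R]_2) (a : 'rV[R]_2) : 0 < \det g ->
  g 1 0 = g 0 1 ->
  Num.sqrt (\det g) * (a *m invmx g) 0 0
    = (Num.sqrt (g 0 0 * g 1 1 - g 0 1 * g 0 1))^-1
      * (a 0 0 * g 1 1 - a 0 1 * g 0 1) /\
  Num.sqrt (\det g) * (a *m invmx g) 0 1
    = (Num.sqrt (g 0 0 * g 1 1 - g 0 1 * g 0 1))^-1
      * (a 0 1 * g 0 0 - a 0 0 * g 0 1).
Proof.
move=> D0 gs; have Dn : \det g != 0 by rewrite gt_eqF.
have s0 : Num.sqrt (\det g) != 0 by rewrite gt_eqF // sqrtr_gt0.
have [v00 v01 v10 v11] := invmx2 Dn.
rewrite !mxE !sum2 v00 v01 v10 v11.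
have -> : g 0 0 * g 1 1 - g 0 1 * g 0 1 = \det g by rewrite det2 gs.
have := esym (sqr_sqrtr (ltW D0)).
move: s0; move: (Num.sqrt (\det g)) => s s0 ->.
by rewrite gs; split; field.
Qed.

Lemma vol_raise_eq (g : 'M[R]_2) (a : 'rV[R]_2) (g00 g01 g11 a0 a1 : R) :
  0 < \det g -> g 1 0 = g 0 1 -> g 0 0 = g00 -> g 0 1 = g01 -> g 1 1 = g11 ->
  a 0 0 = a0 -> a 0 1 = a1 ->
  Num.sqrt (\det g) * (a *m invmx g) 0 0
    = (Num.sqrt (g00 * g11 - g01 * g01))^-1 * (a0 * g11 - a1 * g01) /\
  Num.sqrt (\det g) * (a *m invmx g) 0 1
    = (Num.sqrt (g00 * g11 - g01 * g01))^-1 * (a1 * g00 - a0 * g01).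
Proof. by move=> D0 gs <- <- <- <- <-; exact: vol_raise. Qed.

Lemma derive_rsqrtM (E : normedModType R) (D Y : E -> R) (u v : E) (dD dY : R) :
  differentiable D u -> 0 < D u -> is_derive u v D dD -> is_derive u v Y dY ->
  'D_v (fun w => (Num.sqrt (D w))^-1 * Y w) u
  = - ((Num.sqrt (D u))^-1 / (2 * D u)) * dD * Y u
    + (Num.sqrt (D u))^-1 * dY :> R.
Proof.
move=> diffD D0 [_ DD] DY; have := derive_rsqrt v diffD D0; rewrite DD => Dr.
have [_ e] := is_deriveM Dr DY.
by apply: etrans e _; rewrite /GRing.scale /= addrC [Y u * _]mulrC.
Qed.

(* The divergence [d_i (sqrt |g| X^i)] of the vector field [X] dual to [a]:
   here [c_kij = <d_k F, d_i d_j F>], [b] is the covariant derivative of [a] and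
   [r = 1 / sqrt |g|]. *)
Lemma divergence_identity (r g00 g01 g11 x0 x1 b00 b01 b11
    c000 c001 c011 c100 c101 c111 : R) :
  let D := g00 * g11 - g01 * g01 in
  let a0 := x0 * g00 + x1 * g01 in let a1 := x0 * g01 + x1 * g11 in
  let d0a0 := b00 + (x0 * c000 + x1 * c100) in
  let d0a1 := b01 + (x0 * c001 + x1 * c101) in
  let d1a0 := b01 + (x0 * c001 + x1 * c101) in
  let d1a1 := b11 + (x0 * c011 + x1 * c111) in
  let d0g00 := c000 + c000 in let d1g00 := c001 + c001 in
  let d0g01 := c100 + c001 in let d1g01 := c101 + c011 in
  let d0g11 := c101 + c101 in let d1g11 := c111 + c111 in
  let d0D := d0g00 * g11 + g00 * d0g11 - (d0g01 * g01 + g01 * d0g01) in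
  let d1D := d1g00 * g11 + g00 * d1g11 - (d1g01 * g01 + g01 * d1g01) in
  D != 0 ->
  - (r / (2 * D)) * d0D * (a0 * g11 - a1 * g01)
  + r * (d0a0 * g11 + a0 * d0g11 - (d0a1 * g01 + a1 * d0g01))
  + (- (r / (2 * D)) * d1D * (a1 * g00 - a0 * g01)
     + r * (d1a1 * g00 + a1 * d1g00 - (d1a0 * g01 + a0 * d1g01)))
  = r * (g00 * b11 + g11 * b00 - 2 * g01 * b01).
Proof. by move=> /= D0; field. Qed.

End Divergence.

Lemma dotp_comb (R : realType) (n : nat) (m p q y : 'rV[R]_n) (a b : R) :
  m = a *: p + b *: q -> dotp m y = a * dotp p y + b * dotp q y.
Proof. by move=> ->; rewrite dotpDl !dotpZl. Qed.

(** * Vanishing of the codifferential *)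

Section Coclosed.
Context {R : realType} {n : nat}.
Variables (theta phi : R) (M : set 'rV[R]_n) (mu : 'rV[R]_n -> 'rV[R]_n).
Hypothesis phiE : phi = theta - (n%:R - 2) * (pi / 2).
Hypothesis s0 : sin phi = 0.
Hypothesis cmu : forall x, M x -> cotangent M x (mu x).
Hypothesis sL : special_lagrangian theta (twisted_conormal M mu).
Variables (V : set 'rV[R]_2) (F : 'rV[R]_2 -> 'rV[R]_n).
Hypothesis lp : local_param M V F.
Hypothesis smu : smooth_on V (mu \o F).

Lemma codiff1_eq0 u : V u -> codiff1 (metric F) (components F mu) u = 0.
Proof.
move=> Vu.
(* These inner products agree with the entries of [metric] and [components] on [V], where [F] is
   differentiable; [E0] and [E1] make the replacement near [u]. *)
pose g i j w := dotp (partial i F w) (partial j F w).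
pose a j w := dotp ((mu \o F) w) (partial j F w).
pose D w := g 0 0 w * g 1 1 w - g 0 1 w * g 0 1 w.
pose Y0 w := a 0 w * g 1 1 w - a 1 w * g 0 1 w.
pose Y1 w := a 1 w * g 0 0 w - a 0 w * g 0 1 w.
have nV : \forall w \near u, V w := open_nbhs_nbhs (conj (param_open lp) Vu).
have gE i j w : V w -> metric F w i j = g i j w.
  by move=> Vw; exact: metricE (param_diff lp Vw).
have aE j w : V w -> components F mu w 0 j = a j w.
  move=> Vw; rewrite /a (partial_jacobian j (param_diff lp Vw)) /components.
  by rewrite mulmx_trE row_id.
have volE w (Vw : V w) := vol_raise_eq
  (det_metric_gt0 lp Vw) (metric_sym F w 1 0)
  (gE 0 0 w Vw) (gE 0 1 w Vw) (gE 1 1 w Vw) (aE 0 w Vw) (aE 1 w Vw).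
have E0 : partial 0 (fun w => vol_density (metric F) w *
      (components F mu w *m invmx (metric F w)) 0 0) u =
    partial 0 (fun w => (Num.sqrt (D w))^-1 * Y0 w) u.
  apply: near_eq_derive; near=> w; have Vw : V w by exact: (near nV w).
  exact (proj1 (volE w Vw)).
have E1 : partial 1 (fun w => vol_density (metric F) w *
      (components F mu w *m invmx (metric F w)) 0 1) u =
    partial 1 (fun w => (Num.sqrt (D w))^-1 * Y1 w) u.
  apply: near_eq_derive; near=> w; have Vw : V w by exact: (near nV w).
  exact (proj2 (volE w Vw)).
have dF i : differentiable (partial i F) u by exact (partial_diff lp i Vu).
have dm : differentiable (mu \o F) u by exact: smooth_on_differentiable smu Vu.
(* The Christoffel symbols of the first kind; [Dg] expresses the derivatives of the metric by
   them. *)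
pose c k i j := dotp (partial k F u) (partial i (partial j F) u).
have cs k : c k 1 0 = c k 0 1.
  exact (congr1 (dotp (partial k F u)) (partial_sym lp Vu 1 0)).
have Dg l i j : is_derive u (delta_mx 0 l) (g i j) (c j l i + c i l j).
  apply: is_derive_eq (is_derive_dotp (delta_mx 0 l) (dF i) (dF j)) _.
  exact (congr1 (fun y : R => y + c i l j) (dotpC _ _)).
(* As [mu] is tangential, its products with the second derivatives of [F] are combinations of the
   symbols [c]. *)
have [x xE] := cotangent_jacobian lp Vu (cmu (param_in lp Vu)).
have muE : mu (F u) = x 0 0 *: partial 0 F u + x 0 1 *: partial 1 F u.
  rewrite xE -(deriveEjacobian x (param_diff lp Vu)).
  exact: derive_partial2 (param_diff lp Vu).
have muD y : dotp (mu (F u)) y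
    = x 0 0 * dotp (partial 0 F u) y + x 0 1 * dotp (partial 1 F u) y.
  exact: dotp_comb muE.
have Da l j : is_derive u (delta_mx 0 l) (a j)
    (nabla_form mu F u l j + (x 0 0 * c 0 l j + x 0 1 * c 1 l j)).
  apply: is_derive_eq (is_derive_dotp (delta_mx 0 l) dm (dF j)) _.
  exact (congr1 (fun y : R => nabla_form mu F u l j + y) (muD _)).
have aU j : a j u = x 0 0 * g 0 j u + x 0 1 * g 1 j u.
  exact (muD _).
have dg i j : differentiable (g i j) u.
  have sg : smooth_on V (g i j).
    move=> r; exact: Ck_on_dotp (param_open lp) (partial_smooth lp i r)
      (partial_smooth lp j r).
  exact: smooth_on_differentiable sg Vu.
have dD : differentiable D u.
  by apply: differentiableB; apply: differentiableM.
have D0 : 0 < D u.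
  have := metric_pos lp Vu.
  by rewrite (gE 0 0) // (gE 1 1) // (gE 0 1) // expr2.
have DD l := is_derive_mulB (Dg l 0 0) (Dg l 1 1) (Dg l 0 1) (Dg l 0 1).
have DY0 := is_derive_mulB (Da 0 0) (Dg 0 1 1) (Da 0 1) (Dg 0 0 1).
have DY1 := is_derive_mulB (Da 1 1) (Dg 1 0 0) (Da 1 0) (Dg 1 0 1).
have F0 := derive_rsqrtM dD D0 (DD 0) DY0.
have F1 := derive_rsqrtM dD D0 (DD 1) DY1.
have [tr _] := traces_eq0 phiE sL lp smu s0 Vu (@conormal0 R n M (F u)).
have tr' : g 0 0 u * nabla_form mu F u 1 1 + g 1 1 u * nabla_form mu F u 0 0
    - 2 * g 0 1 u * nabla_form mu F u 0 1 = 0.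
  by rewrite -(gE 0 0) // -(gE 1 1) // -(gE 0 1).
have ns := nabla_sym sL lp smu 1 0 Vu.
have g10 : g 1 0 u = g 0 1 u by exact (dotpC _ _).
(* After the symmetries [cs], [ns] and [g10], this is the left side of [divergence_identity], a
   multiple of the trace [tr']. *)
have sum0 : 'D_(delta_mx 0 0) (fun w => (Num.sqrt (D w))^-1 * Y0 w) u
    + 'D_(delta_mx 0 1) (fun w => (Num.sqrt (D w))^-1 * Y1 w) u = 0 :> R.
  apply: etrans (congr2 +%R F0 F1) _.
  have Dn : D u != 0 by rewrite gt_eqF.
  move: Dn; clear - cs ns aU g10 tr'; rewrite /D; clearbody c g a.
  rewrite (cs 0) (cs 1) ns !aU g10 => Dn.
  apply: etrans (divergence_identity _ _ _ _ _ _ _ _ _ _ _ _ Dn) _.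
  by rewrite tr' mulr0.
rewrite /codiff1 sum2 E0 E1.
exact: etrans (congr1 _ sum0) (mulr0 _).
Unshelve. all: by end_near. Qed.

End Coclosed.

(** * Harmonicity and the conclusion *)

Lemma codiff2_eq0 (R : realType) k (g om : 'rV[R]_k -> 'M[R]_k)
    (V : set 'rV[R]_k) u : open V -> V u -> (forall w, V w -> om w = 0) ->
  codiff2 g om u = 0.
Proof.
move=> oV Vu om0; rewrite /codiff2.
set r := (\row_l _); have -> : r = 0.
  apply/rowP => l; rewrite !mxE big1 // => i _.
  apply: (partial_eq0 _ oV Vu) => w Vw.
  by rewrite om0 // mulmx0 mul0mx mxE mulr0.
by rewrite scaler0 mul0mx.
Qed.

(** Both summands differentiate once more, so the vanishing is assumed on an open set around [u]. *)
Lemma hodge_laplacian_eq0 (R : realType) k (g : 'rV[R]_k -> 'M[R]_k)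
    (a : 'rV[R]_k -> 'rV[R]_k) (V : set 'rV[R]_k) u : open V -> V u ->
  (forall w, V w -> ext_deriv a w = 0) ->
  (forall w, V w -> codiff1 g a w = 0) ->
  hodge_laplacian g a u = 0.
Proof.
move=> oV Vu a0 d0; rewrite /hodge_laplacian (codiff2_eq0 g oV Vu a0) addr0.
by apply/rowP => j; rewrite !mxE; exact: (partial_eq0 j oV Vu d0).
Qed.

Theorem proposition2p7 (R : realType) (n : nat) (theta phi : R)
    (M : set 'rV[R]_n) (mu : 'rV[R]_n -> 'rV[R]_n) :
  twisted_austere 2 theta M mu ->
  ~ totally_geodesic 2 M ->
  phi = theta - (n%:R - 2) * (pi / 2) ->
  sin phi = 0 /\
  [/\ minimal 2 M, closed_form 2 M mu, coclosed_form 2 M mu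
    & harmonic_form 2 M mu].
Proof.
move=> [_ [cmu smu] sL] ntg phiE.
have s0 : sin phi = 0.
  (* If [sin phi] were nonzero, every second form in every parametrization would vanish. As [phi] is
     constant, one point that is not geodesic decides for all of [M]. *)
  apply: contra_notP ntg => s0 V F lp u Vu i j; apply/eqP/negPn/negP => II0.
  exact: s0 (sin_phase_eq0 phiE sL lp (smu _ _ lp) Vu II0).
have closed V (F : 'rV[R]_2 -> 'rV[R]_n) (lp : local_param M V F)
    u (Vu : V u) :=
  ext_deriv_eq0 sL lp (smu _ _ lp) Vu.
have coclosed V (F : 'rV[R]_2 -> 'rV[R]_n) (lp : local_param M V F)
    u (Vu : V u) :=
  codiff1_eq0 phiE s0 cmu sL lp (smu _ _ lp) Vu.
split=> //; split=> V F lp u Vu.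
- exact (mean_curvature_eq0 phiE sL lp (smu _ _ lp) s0 Vu).
- exact (closed V F lp u Vu).
- exact (coclosed V F lp u Vu).
- exact (hodge_laplacian_eq0 (param_open lp) Vu
    (closed V F lp) (coclosed V F lp)).
Qed.
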